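(* Let $n$ be a positive integer, $H$ an $n\times n$ contraction, $L$ a self-adjoint $n\times n$ matrix, and $p,q\in\mathbf R$. Consider on positive definite $n\times n$ matrices $A$ the trace function \[ \varphi^L_{p,q}(A)=\operatorname{Tr}\Bigl[\exp_p\bigl(L+H^*\log_p(A)H\bigr)^q\Bigr]. \] Then: (a) $\varphi^L_{p,q}$ is concave if $0\le p\le1$, $L\le0$, $0\le q\le1$; (b) $\varphi^L_{p,q}$ is concave if $1\le p\le2$, $L\ge0$, $0\le q\le1$; (c) $\varphi^L_{p,q}$ is convex if $0\le p\le1$, $L\le0$, $q\le0$; (d) $\varphi^L_{p,q}$ is convex if $1\le p\le2$, $L\ge0$, $q\le0$; (e) $\varphi^L_{p,q}$ is convex if $2\le p\le3$, $L\ge0$, $q\ge1$.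
   Context: For $p\in\mathbf R$, the deformed logarithm is $\log_p x=\int_1^x t^{p-2}dt$ for $x>0$, i.e. $\frac{x^{p-1}-1}{p-1}$ for $p\neq1$ and $\log x$ for $p=1$; the deformed exponential $\exp_p$ is its inverse, $\exp_p(x)=(x(p-1)+1)^{1/(p-1)}$ on $x>-(p-1)^{-1}$ when $p>1$, on $x<-(p-1)^{-1}$ when $p<1$, and $\exp_1=\exp$ on $\mathbf R$. Both are applied to self-adjoint matrices by functional calculus. A contraction is a matrix of operator norm at most $1$. Under the stated sign conditions on $L$ ($L\ge0$ when $p>1$, $L\le0$ when $p<1$), the spectrum of $L+H^*\log_p(A)H$ lies in the domain of $\exp_p$, so $\exp_p(L+H^*\log_p(A)H)$ is a positive definite matrix and its $q$-th power is defined by functional calculus. *)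

(* Defs.v *)
From HB Require Import structures.
From mathcomp Require Import all_boot all_order all_algebra.
From mathcomp Require Import sesquilinear spectral.
From mathcomp Require Import complex.
From mathcomp Require Import reals exp sequences.
Set Implicit Arguments. Unset Strict Implicit. Unset Printing Implicit Defensive.
Import Order.TTheory GRing.Theory Num.Theory Num.Def.
Local Open Scope ring_scope.
Local Open Scope complex_scope.

Section Defs.
Variable R : realType.
Local Notation C := R[i].

Definition adj m n (M : 'M[C]_(m, n)) : 'M[C]_(n, m) := map_mx conjC (M ^T).

Definition selfadj n (A : 'M[C]_n) : Prop := A \is hermsymmx.

(* positive semidefinite / positive definite, via the quadratic form v^* A v
   (the order on C = R[i] means: real and nonnegative / positive) *)
Definition psdmx n (A : 'M[C]_n) : Prop :=
  selfadj A /\ forall v : 'cV[C]_n, 0 <= (adj v *m A *m v) 0 0.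
Definition pdmx n (A : 'M[C]_n) : Prop :=
  selfadj A /\ forall v : 'cV[C]_n, v != 0 -> 0 < (adj v *m A *m v) 0 0.

Definition contraction n (H : 'M[C]_n) : Prop :=
  forall v : 'cV[C]_n, (adj (H *m v) *m (H *m v)) 0 0 <= (adj v *m v) 0 0.

Definition mxfun n (f : R -> R) (A : 'M[C]_n) : 'M[C]_n :=
  invmx (spectralmx A) *m
  diag_mx (map_mx (fun z : C => (f (complex.Re z))%:C) (spectral_diag A)) *m
  spectralmx A.

Definition logp (p x : R) : R :=
  if p == 1 then ln x else (powR x (p - 1) - 1) / (p - 1).
Definition expp (p x : R) : R :=
  if p == 1 then expR x else powR (x * (p - 1) + 1) (1 / (p - 1)).

Definition phiLpq n (H L : 'M[C]_n) (p q : R) (A : 'M[C]_n) : C :=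
  \tr (mxfun (fun x => powR x q)
        (mxfun (expp p) (L + adj H *m mxfun (logp p) A *m H))).

Definition concave_pd n (phi : 'M[C]_n -> C) : Prop :=
  forall A B : 'M[C]_n, pdmx A -> pdmx B -> forall t : R, 0 <= t <= 1 ->
    t%:C * phi A + (1 - t)%:C * phi B <= phi (t%:C *: A + (1 - t)%:C *: B).
Definition convex_pd n (phi : 'M[C]_n -> C) : Prop :=
  forall A B : 'M[C]_n, pdmx A -> pdmx B -> forall t : R, 0 <= t <= 1 ->
    phi (t%:C *: A + (1 - t)%:C *: B) <= t%:C * phi A + (1 - t)%:C * phi B.

End Defs.

(* Main.v *)
(* Write s = p - 1, r = q / s and, for p <> 1, Y(A) = s L + 1 - H^*H + H^*A^s H,
   so that the trace function is Tr Y(A)^r. The constant term is positive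
   semidefinite, say M^*M, because H is a contraction.

   A real kernel h defines a double operator function of (A, B), whose quadratic
   form at K reads sum_ij |k_ij|^2 h(a_i, b_j) in eigenbases of A and B. The
   kernels whose quadratic form is jointly concave form a closed cone containing
   a and b, stable under parallel sums (an infimum over X of forms linear in
   (A, B)), hence under geometric means (iterate the arithmetic and harmonic
   means), hence containing a^s b^(1-s) for s in [0, 1] (dyadic s first): Lieb's
   concavity theorem. Parallel sums also give -a^2/h for h in the cone, that is
   Ando's convexity theorem for s in [-1, 0] and [1, 2]; and s -> 0 gives
   b (ln a - ln b).

   By Bernoulli's inequality y^r is the maximum or the minimum over b > 0 of
   r y b^(1-s) + (1-r) b^e with e = r (1-s) / (r-1), hence Tr Y^r is the maximum
   or the minimum over B > 0 of r Tr(Y B^(1-s)) + (1-r) Tr B^e. When the kind of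
   extremum fits, the theorem follows from the joint concavity or convexity in
   (A, B); otherwise y^r is monotone and concave or convex, and the operator
   concavity or convexity of A^s is enough. The case p = 1 is the same with
   logarithms in place of powers. *)
From mathcomp Require Import all_boot all_order all_algebra.
From mathcomp Require Import all_classical topology normedtype ring lra.
Require Import Defs.
From HB Require Import structures.
From mathcomp Require Import all_boot all_order all_algebra.
From mathcomp Require Import sesquilinear spectral complex.
From mathcomp Require Import reals exp sequences.
Import Order.TTheory GRing.Theory Num.Theory.
Import numFieldNormedType.Exports.
Local Open Scope ring_scope.
Local Open Scope complex_scope.

Set Implicit Arguments. Unset Strict Implicit. Unset Printing Implicit Defensive.

(** * Functional calculus of self-adjoint matrices, real traces and double operator sums *)

Section FunctionalCalculus.
Variable R : realType.
Local Notation C := R[i].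

Lemma adjM m n k (A : 'M[C]_(m, n)) (B : 'M[C]_(n, k)) :
  adj (A *m B) = adj B *m adj A.
Proof. by rewrite /adj trmx_mul map_mxM. Qed.

Lemma adjK m n (A : 'M[C]_(m, n)) : adj (adj A) = A.
Proof. by apply/matrixP=> i j; rewrite !mxE conjCK. Qed.

Lemma adjD m n (A B : 'M[C]_(m, n)) : adj (A + B) = adj A + adj B.
Proof. by rewrite /adj linearD map_mxD. Qed.

Lemma adjN m n (A : 'M[C]_(m, n)) : adj (- A) = - adj A.
Proof. by rewrite /adj linearN map_mxN. Qed.

Lemma adjZ m n (c : R) (A : 'M[C]_(m, n)) : adj (c%:C *: A) = c%:C *: adj A.
Proof. by apply/matrixP=> i j; rewrite !mxE rmorphM; congr (_ * _); exact: conjc_real. Qed.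

Lemma adj_1mx n : adj (1%:M : 'M[C]_n) = 1%:M.
Proof. by rewrite /adj trmx1 map_mx1. Qed.

Lemma selfadjP n (A : 'M[C]_n) : selfadj A <-> adj A = A.
Proof.
by split=> [/is_hermitianmxP|e]; [|apply/is_hermitianmxP]; rewrite expr0 scale1r.
Qed.

Lemma selfadjD n (A B : 'M[C]_n) : selfadj A -> selfadj B -> selfadj (A + B).
Proof. by move=> /selfadjP hA /selfadjP hB; apply/selfadjP; rewrite adjD hA hB. Qed.

Lemma selfadjZ n (c : R) (A : 'M[C]_n) : selfadj A -> selfadj (c%:C *: A).
Proof. by move=> /selfadjP hA; apply/selfadjP; rewrite adjZ hA. Qed.

Lemma selfadj1 n : selfadj (1%:M : 'M[C]_n).
Proof. by apply/selfadjP; rewrite adj_1mx. Qed.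

Lemma selfadj_conj m n (K : 'M[C]_(m, n)) A : selfadj A -> selfadj (adj K *m A *m K).
Proof. by move=> /selfadjP hA; apply/selfadjP; rewrite !adjM adjK hA mulmxA. Qed.

Definition rdiag n (d : 'I_n -> R) : 'M[C]_n := diag_mx (\row_i (d i)%:C).

Lemma eq_rdiag n (d e : 'I_n -> R) : d =1 e -> rdiag d = rdiag e.
Proof. by move=> h; congr diag_mx; apply/rowP => i; rewrite !mxE h. Qed.

Lemma rdiagM n (d e : 'I_n -> R) : rdiag d *m rdiag e = rdiag (fun i => d i * e i).
Proof.
apply/matrixP => i j; rewrite mul_diag_mx !mxE; case: eqP => [->|_].
  by rewrite !mulr1n rmorphM.
by rewrite !mulr0n mulr0.
Qed.

Lemma rdiagD n (d e : 'I_n -> R) : rdiag d + rdiag e = rdiag (fun i => d i + e i).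
Proof. by apply/matrixP => i j; rewrite !mxE -mulrnDl rmorphD. Qed.

Lemma rdiagZ n (c : R) (d : 'I_n -> R) : c%:C *: rdiag d = rdiag (fun i => c * d i).
Proof. by apply/matrixP => i j; rewrite !mxE mulrnAr rmorphM. Qed.

Lemma rdiag_cst n (c : R) : rdiag (fun _ : 'I_n => c) = c%:C%:M.
Proof. by rewrite -diag_const_mx; congr diag_mx; apply/rowP => i; rewrite !mxE. Qed.

Lemma adj_rdiag n (d : 'I_n -> R) : adj (rdiag d) = rdiag d.
Proof.
rewrite /adj /rdiag tr_diag_mx map_diag_mx; congr diag_mx.
by apply/rowP => i; rewrite !mxE; exact: conjc_real.
Qed.

(** Entrywise the hypothesis reads d_i W_ij = W_ij e_j, so W_ij = 0 or d_i = e_j; either way [f] may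
    be applied. *)
Lemma rdiag_intertwine n f (d e : 'I_n -> R) (W : 'M[C]_n) :
  rdiag d *m W = W *m rdiag e ->
  rdiag (fun i => f (d i)) *m W = W *m rdiag (fun i => f (e i)).
Proof.
rewrite !mul_diag_mx !mul_mx_diag => /matrixP h.
apply/matrixP => i j; move: (h i j); rewrite !mxE => /eqP.
rewrite -subr_eq0 mulrC -mulrBr mulf_eq0 => /orP[/eqP->|].
  by rewrite mulr0 mul0r.
by rewrite subr_eq0 => /eqP[->]; rewrite mulrC.
Qed.

(* [locked] keeps unification from unfolding the spectral decomposition. *)
Definition eigbasis n : 'M[C]_n -> 'M[C]_n := locked (@spectralmx _ n).
Definition eigv n : 'M[C]_n -> 'I_n -> R :=
  locked (fun A i => complex.Re (spectral_diag A 0 i)).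
Definition fcalc n : (R -> R) -> 'M[C]_n -> 'M[C]_n := locked (@mxfun R n).
Local Notation U A := (eigbasis A).

Lemma mxfun_fcalc n f (A : 'M[C]_n) : mxfun f A = fcalc f A.
Proof. by rewrite /fcalc; case: _ / (lock (@mxfun R n)). Qed.

Lemma eigbasisE n (A : 'M[C]_n) : U A = spectralmx A.
Proof. by rewrite /eigbasis; case: _ / (lock (@spectralmx _ n)). Qed.

Lemma eigvE n (A : 'M[C]_n) i : eigv A i = complex.Re (spectral_diag A 0 i).
Proof. by rewrite /eigv; case: _ / (lock (fun _ _ => complex.Re _)). Qed.

Lemma spectralV n (A : 'M[C]_n) : U A *m adj (U A) = 1%:M.
Proof. by rewrite eigbasisE; apply/unitarymxP/spectral_unitarymx. Qed.

Lemma spectralVl n (A : 'M[C]_n) : adj (U A) *m U A = 1%:M.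
Proof. exact/mulmx1C/spectralV. Qed.

Lemma fcalcE n f (A : 'M[C]_n) :
  fcalc f A = adj (U A) *m rdiag (fun i => f (eigv A i)) *m U A.
Proof.
rewrite -mxfun_fcalc eigbasisE (eq_rdiag (fun i => congr1 f (eigvE A i))).
have V := invmx_unitary (spectral_unitarymx A).
rewrite /mxfun V; congr (_ *m diag_mx _ *m _).
by apply/rowP => i; rewrite !mxE.
Qed.

Lemma fcalc_id n (A : 'M[C]_n) : selfadj A -> fcalc id A = A.
Proof.
move=> hA; have /orthomx_spectralP/= e := hermitian_normalmx hA.
have r := hermitian_spectral_diag_real hA.
rewrite -mxfun_fcalc /mxfun; apply: etrans (esym e).
have -> // : map_mx (fun z => (id (complex.Re z))%:C) (spectral_diag A) = spectral_diag A.
apply/rowP => i; rewrite mxE; apply: RRe_real; exact: mxOverP r _ _.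
Qed.

Lemma eq_fcalc n f g (A : 'M[C]_n) :
  (forall i, f (eigv A i) = g (eigv A i)) -> fcalc f A = fcalc g A.
Proof. by move=> h; rewrite !fcalcE (eq_rdiag h). Qed.

(* Uniqueness of the functional calculus: a matrix intertwining two diagonal
   matrices intertwines their images under [f] as well. *)
Lemma fcalc_unitary n f (A V : 'M[C]_n) (d : 'I_n -> R) :
  V *m adj V = 1%:M -> A = adj V *m rdiag d *m V ->
  fcalc f A = adj V *m rdiag (fun i => f (d i)) *m V.
Proof.
move=> VV eA; have VV' := mulmx1C VV.
have hA : selfadj A.
  by apply/selfadjP; rewrite eA !adjM adjK adj_rdiag mulmxA.
have eV : A *m adj V = adj V *m rdiag d by rewrite {1}eA -mulmxA VV mulmx1.
have := fcalc_id hA; rewrite !fcalcE.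
set W := U A *m adj V => e.
have {e} : rdiag (eigv A) *m W = W *m rdiag d.
  move/(congr1 (fun M => U A *m M *m adj V)): e.
  by rewrite /= !mulmxA spectralV mul1mx -!mulmxA eV => ->.
move=> e.
have e' : rdiag (fun i => f (eigv A i)) *m W = W *m rdiag (fun i => f (d i)).
  by apply: rdiag_intertwine e.
move/(congr1 (fun M => adj (U A) *m M *m V)): e'.
rewrite /= /W !mulmxA spectralVl mul1mx => <-.
by rewrite -!mulmxA VV' mulmx1.
Qed.

Lemma fcalc_comp n f g (A : 'M[C]_n) : fcalc g (fcalc f A) = fcalc (g \o f) A.
Proof.
by rewrite (@fcalc_unitary _ g _ (U A) (fun i => f (eigv A i))) ?spectralV ?fcalcE.
Qed.

Lemma selfadj_fcalc n f (A : 'M[C]_n) : selfadj (fcalc f A).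
Proof. by apply/selfadjP; rewrite fcalcE !adjM adjK adj_rdiag mulmxA. Qed.

Lemma fcalc_cst n c (A : 'M[C]_n) : fcalc (fun=> c) A = c%:C%:M.
Proof.
by rewrite fcalcE rdiag_cst -scalemx1 -scalemxAr mulmx1 -scalemxAl spectralVl.
Qed.

Lemma fcalcM n f g (A : 'M[C]_n) :
  fcalc f A *m fcalc g A = fcalc (fun x => f x * g x) A.
Proof.
rewrite !fcalcE !mulmxA -(mulmxA _ (U A)) spectralV mulmx1.
by rewrite -(mulmxA (adj _)) rdiagM.
Qed.

Lemma fcalcD n f g (A : 'M[C]_n) :
  fcalc f A + fcalc g A = fcalc (fun x => f x + g x) A.
Proof. by rewrite !fcalcE -mulmxDl -mulmxDr rdiagD. Qed.

Lemma fcalcZ n c f (A : 'M[C]_n) :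
  c%:C *: fcalc f A = fcalc (fun x => c * f x) A.
Proof. by rewrite !fcalcE scalemxAl scalemxAr rdiagZ. Qed.

Lemma fcalc_affine n (c : R) (A : 'M[C]_n) : selfadj A ->
  fcalc (fun x => 1 + c * x) A = 1%:M + c%:C *: A.
Proof.
by move=> hA; rewrite -fcalcD -(fcalcZ c id) fcalc_id // fcalc_cst.
Qed.

Lemma fcalc1 n f : fcalc f (1%:M : 'M[C]_n) = (f 1)%:C%:M.
Proof.
rewrite (@fcalc_unitary _ f _ 1%:M (fun=> 1)) ?adj_1mx ?mulmx1 ?mul1mx //.
  by rewrite rdiag_cst.
by rewrite rdiag_cst.
Qed.

(** The real part is taken so that inequalities live in [R]; by [mxtrace_fcalc] nothing is lost for
    traces of functions of a matrix. *)
Definition rtr n (M : 'M[C]_n) : R := complex.Re (\tr M).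

Lemma rtrD n (A B : 'M[C]_n) : rtr (A + B) = rtr A + rtr B.
Proof. by rewrite /rtr linearD raddfD. Qed.

Lemma rtrN n (A : 'M[C]_n) : rtr (- A) = - rtr A.
Proof. by rewrite /rtr linearN raddfN. Qed.

Lemma rtrZ n c (A : 'M[C]_n) : rtr (c%:C *: A) = c * rtr A.
Proof. by rewrite /rtr linearZ /=; case: (\tr A) => x y /=; rewrite mul0r subr0. Qed.

Lemma rtrC m n (A : 'M[C]_(m, n)) B : rtr (A *m B) = rtr (B *m A).
Proof. by rewrite /rtr mxtrace_mulC. Qed.

Lemma mxtrace_fcalc n f (A : 'M[C]_n) :
  \tr (fcalc f A) = (\sum_i f (eigv A i))%:C.
Proof.
rewrite fcalcE mxtrace_mulC mulmxA spectralV mul1mx mxtrace_diag rmorph_sum.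
by apply: eq_bigr => i _; rewrite mxE.
Qed.

Lemma rtr_fcalc n f (A : 'M[C]_n) : rtr (fcalc f A) = \sum_i f (eigv A i).
Proof. by rewrite /rtr mxtrace_fcalc. Qed.

Definition nsq (z : C) : R := complex.Re z ^+ 2 + complex.Im z ^+ 2.

Lemma nsq_ge0 z : 0 <= nsq z.
Proof. by rewrite addr_ge0 ?sqr_ge0. Qed.

Lemma Re_conj_sandwich (z : C) (a b : R) :
  complex.Re (conjc z * (a%:C * z * b%:C)) = nsq z * (a * b).
Proof. by case: z => x y; rewrite /nsq /=; ring. Qed.

Lemma nsqM (c : R) z : nsq (c%:C * z) = c ^+ 2 * nsq z.
Proof. by case: z => x y; rewrite /nsq /=; ring. Qed.

(* The quadratic form of the double operator function [h (A, B)], evaluated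
   at [K]: for [h a b = f a * g b] this is [Tr (K^* f(A) K g(B))]. *)
Definition dsum m n (h : R -> R -> R) (K : 'M[C]_(m, n)) A B : R :=
  \sum_i \sum_j nsq ((U A *m K *m adj (U B)) i j) * h (eigv A i) (eigv B j).

(** With W = U_A K U_B^*, cyclicity of the trace leaves the sum over i, j of conj(W_ij) f(a_i) W_ij
    g(b_j). *)
Lemma dsum_prod m n f g (K : 'M[C]_(m, n)) A B :
  dsum (fun a b => f a * g b) K A B = rtr (adj K *m fcalc f A *m K *m fcalc g B).
Proof.
rewrite !fcalcE.
set a := fun i => f _; set b := fun i => g _.
set W := U A *m K *m adj (U B).
have -> : rtr (adj K *m (adj (U A) *m rdiag a *m U A) *m K *m
   (adj (U B) *m rdiag b *m U B)) = rtr (adj W *m (rdiag a *m W *m rdiag b)).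
  by rewrite mulmxA rtrC /W !adjM adjK !mulmxA.
rewrite /rtr /dsum /mxtrace (raddf_sum (@complex.Re R)).
rewrite exchange_big /=; apply: eq_bigr => j _.
rewrite [X in complex.Re X]mxE (raddf_sum (@complex.Re R)); apply: eq_bigr => i _.
rewrite mul_mx_diag [X in _ = complex.Re (_ * X)]mxE mul_diag_mx.
rewrite !mxE -/a.
exact/esym/Re_conj_sandwich.
Qed.

End FunctionalCalculus.

(** * Quadratic forms, positivity and convex combinations *)

Section Positivity.
Variable R : realType.
Local Notation C := R[i].
Local Notation U A := (eigbasis A).

Definition mix n (t : R) (A B : 'M[C]_n) := t%:C *: A + (1 - t)%:C *: B.

Definition qform n (A : 'M[C]_n) (v : 'cV[C]_n) : R :=
  complex.Re ((adj v *m A *m v) 0 0).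

Lemma qformD n (A B : 'M[C]_n) v : qform (A + B) v = qform A v + qform B v.
Proof. by rewrite /qform mulmxDr mulmxDl mxE raddfD. Qed.

Lemma qformZ n c (A : 'M[C]_n) v : qform (c%:C *: A) v = c * qform A v.
Proof.
rewrite /qform -scalemxAr -scalemxAl mxE.
by case: (_ 0 0) => x y /=; rewrite mul0r subr0.
Qed.

Lemma qformN n (A : 'M[C]_n) v : qform (- A) v = - qform A v.
Proof. by rewrite /qform mulmxN mulNmx mxE raddfN. Qed.

Lemma qform_conj m n (A : 'M[C]_m) (K : 'M[C]_(m, n)) v :
  qform (adj K *m A *m K) v = qform A (K *m v).
Proof. by rewrite /qform adjM !mulmxA. Qed.

Lemma adj_sqE n (v : 'cV[C]_n) : (adj v *m v) 0 0 = (\sum_i nsq (v i 0))%:C.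
Proof.
rewrite mxE (rmorph_sum (real_complex R)); apply: eq_bigr => i _.
by rewrite !mxE; case: (v i 0) => x y; rewrite /nsq /=; simpc; apply/eqP;
  rewrite eq_complex /=; apply/andP; split; apply/eqP; ring.
Qed.

Lemma qform_fcalc n f (A : 'M[C]_n) v :
  qform (fcalc f A) v = \sum_i f (eigv A i) * nsq ((U A *m v) i 0).
Proof.
rewrite fcalcE qform_conj /qform mul_mx_diag mxE (raddf_sum (@complex.Re R)).
apply: eq_bigr => i _; rewrite !mxE.
by case: (\sum_ _ _) => x y; rewrite /nsq /=; ring.
Qed.

(** The product v^* A v is a self-adjoint 1 by 1 matrix, hence a real number. *)
Lemma selfadj_qform n (A : 'M[C]_n) v : selfadj A ->
  (adj v *m A *m v) 0 0 = (qform A v)%:C.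
Proof.
move=> hA; have /selfadjP : selfadj (adj v *m A *m v) by exact: selfadj_conj.
rewrite /qform => /matrixP/(_ 0 0); rewrite mxE mxE.
by case: (_ 0 0) => x y /= [h]; congr (_ +i* _); lra.
Qed.

Lemma psdmxP n (A : 'M[C]_n) :
  psdmx A <-> selfadj A /\ forall v, 0 <= qform A v.
Proof.
by split=> -[hA h]; split=> // v; move: (h v);
  rewrite selfadj_qform // ler0c.
Qed.

Lemma pdmxP n (A : 'M[C]_n) :
  pdmx A <-> selfadj A /\ forall v, v != 0 -> 0 < qform A v.
Proof.
by split=> -[hA h]; split=> // v v0; move: (h v v0);
  rewrite selfadj_qform // ltcE /= eqxx.
Qed.

Lemma pdmx_selfadj n (A : 'M[C]_n) : pdmx A -> selfadj A.
Proof. by case. Qed.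

(** The decomposition has the form A = U^* D U, so the eigenvectors are the columns of U^*, not of
    U. *)
Definition eigvec n (A : 'M[C]_n) i : 'cV[C]_n := col i (adj (U A)).

Lemma eigvec_neq0 n (A : 'M[C]_n) i : eigvec A i != 0.
Proof.
apply/eqP => /(congr1 (mulmx (U A))); rewrite /eigvec colE mulmxA spectralV.
rewrite mul1mx mulmx0 => /matrixP/(_ i 0); rewrite !mxE !eqxx.
by move/eqP; rewrite oner_eq0.
Qed.

(** In the eigenbasis of [A] only the diagonal of [M] meets f(A); the sign of the trace can then be
    checked eigenvector by eigenvector. *)
Lemma fcalc_pair n f (A M : 'M[C]_n) :
  rtr (fcalc f A *m M) = \sum_i f (eigv A i) * qform M (eigvec A i).
Proof.
rewrite fcalcE -mulmxA rtrC mulmxA rtrC /rtr /mxtrace (raddf_sum (@complex.Re R)).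
apply: eq_bigr => i _; rewrite mul_diag_mx mxE [X in X * _]mxE.
rewrite /qform /eigvec colE adjM adjK.
have -> : adj (delta_mx i 0 : 'cV[C]_n) = delta_mx 0 i.
  by apply/matrixP => k l; rewrite !mxE conjC_nat andbC.
have -> : delta_mx 0 i *m U A *m M *m (adj (U A) *m delta_mx i 0) =
    row i (col i (U A *m M *m adj (U A))) by rewrite rowE colE !mulmxA.
rewrite [in RHS]mxE [in RHS]mxE.
by case: ((U A *m M *m adj (U A)) i i) => x y /=; ring.
Qed.

Lemma qform_eigvec n (A : 'M[C]_n) i : selfadj A -> qform A (eigvec A i) = eigv A i.
Proof.
move=> hA; rewrite -{1}(fcalc_id hA) qform_fcalc (bigD1 i) //= big1 => [|j ji].
  rewrite /eigvec colE mulmxA spectralV mul1mx mxE !eqxx addr0 /nsq /=.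
  by rewrite expr1n expr0n /= addr0 mulr1.
rewrite /eigvec colE mulmxA spectralV mul1mx mxE (negPf ji) /nsq /=.
by rewrite expr0n /= addr0 mulr0.
Qed.

Lemma eigv_gt0 n (A : 'M[C]_n) i : pdmx A -> 0 < eigv A i.
Proof.
by move=> /pdmxP[hA h]; rewrite -qform_eigvec //; apply: h (eigvec_neq0 _ _).
Qed.

Lemma eigv_ge0 n (A : 'M[C]_n) i : psdmx A -> 0 <= eigv A i.
Proof. by move=> /psdmxP[hA h]; rewrite -qform_eigvec. Qed.

Lemma nsq_eq0 (z : C) : (nsq z == 0) = (z == 0).
Proof.
by rewrite /nsq paddr_eq0 ?sqr_ge0 // !sqrf_eq0 eq_complex.
Qed.

Lemma pdmx_fcalc n f (A : 'M[C]_n) :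
  (forall i, 0 < f (eigv A i)) -> pdmx (fcalc f A).
Proof.
move=> f0; apply/pdmxP; split=> [|v v0]; first exact: selfadj_fcalc.
rewrite qform_fcalc lt0r sumr_ge0 => [|i _]; last first.
  by rewrite mulr_ge0 ?nsq_ge0 // ltW.
rewrite andbT psumr_eq0 => [|i _]; last by rewrite mulr_ge0 ?nsq_ge0 // ltW.
(* If the form vanishes at [v], every coordinate of U v vanishes, and v = 0 because U is unitary. *)
apply: contra v0 => /allP h; apply/eqP.
rewrite -[v]mul1mx -(spectralVl A) -mulmxA.
suff -> : U A *m v = 0 by rewrite mulmx0.
apply/matrixP => i j; rewrite ord1 [RHS]mxE.
have := h i (mem_index_enum _); rewrite /= mulf_eq0 gt_eqF //= nsq_eq0.
by move/eqP.
Qed.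

Lemma pdmx1 n : pdmx (1%:M : 'M[C]_n).
Proof.
by rewrite -(fcalc_cst 1 0); apply: pdmx_fcalc => i.
Qed.

Lemma pdmx_mix n t (A B : 'M[C]_n) : 0 <= t <= 1 ->
  pdmx A -> pdmx B -> pdmx (mix t A B).
Proof.
move=> /andP[t0 t1] /pdmxP[hA pA] /pdmxP[hB pB]; apply/pdmxP.
split=> [|v v0]; first by apply: selfadjD; apply: selfadjZ.
rewrite qformD !qformZ; have := pA v v0; have := pB v v0.
have [->|t'] := eqVneq t 0; first by lra.
have : 0 < t by rewrite lt0r t'.
by nra.
Qed.

(** Writing a constant term as M^* M = M^* f(1) M, when f(1) = 1, gives it the same shape as H^*
    f(A) H. *)
Lemma psdmx_sqrt n (A : 'M[C]_n) : psdmx A -> exists M : 'M[C]_n, adj M *m M = A.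
Proof.
move=> hA; exists (fcalc Num.sqrt A).
have /selfadjP -> := selfadj_fcalc Num.sqrt A.
rewrite fcalcM -[RHS]fcalc_id; last by case: hA.
by apply: eq_fcalc => i; rewrite -expr2 sqr_sqrtr // eigv_ge0.
Qed.

End Positivity.

(** * Jointly concave kernels: cone operations, parallel sums and limits *)

Section Kernels.
Variable R : realType.
Local Notation C := R[i].
Local Notation U A := (eigbasis A).
Implicit Types h : R -> R -> R.

Lemma eq_dsum m n h h' (K : 'M[C]_(m, n)) A B :
  (forall i j, h (eigv A i) (eigv B j) = h' (eigv A i) (eigv B j)) ->
  dsum h K A B = dsum h' K A B.
Proof. by move=> e; apply: eq_bigr => i _; apply: eq_bigr => j _; rewrite e. Qed.

Lemma eq_dsum_pd m n h h' (K : 'M[C]_(m, n)) A B :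
  pdmx A -> pdmx B -> (forall a b, 0 < a -> 0 < b -> h a b = h' a b) ->
  dsum h K A B = dsum h' K A B.
Proof. by move=> hA hB e; apply: eq_dsum => i j; apply: e; apply: eigv_gt0. Qed.

Lemma le_dsum m n h h' (K : 'M[C]_(m, n)) A B :
  (forall i j, h (eigv A i) (eigv B j) <= h' (eigv A i) (eigv B j)) ->
  dsum h K A B <= dsum h' K A B.
Proof.
move=> e; apply: ler_sum => i _; apply: ler_sum => j _.
by rewrite ler_wpM2l ?nsq_ge0.
Qed.

Lemma dsumD m n h h' (K : 'M[C]_(m, n)) A B :
  dsum (fun a b => h a b + h' a b) K A B = dsum h K A B + dsum h' K A B.
Proof.
rewrite -big_split; apply: eq_bigr => i _; rewrite -big_split.
by apply: eq_bigr => j _; rewrite mulrDr.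
Qed.

Lemma dsumZ m n c h (K : 'M[C]_(m, n)) A B :
  dsum (fun a b => c * h a b) K A B = c * dsum h K A B.
Proof.
rewrite mulr_sumr; apply: eq_bigr => i _; rewrite mulr_sumr.
by apply: eq_bigr => j _; rewrite mulrCA.
Qed.

Lemma dsum_fst m n f (K : 'M[C]_(m, n)) A B :
  dsum (fun a _ => f a) K A B = rtr (adj K *m fcalc f A *m K).
Proof.
rewrite (@eq_dsum _ _ _ (fun a b => f a * (fun=> 1) b)) => [|i j]; last by rewrite mulr1.
by rewrite dsum_prod fcalc_cst mulmx1.
Qed.

Lemma dsum_snd m n f (K : 'M[C]_(m, n)) A B :
  dsum (fun _ b => f b) K A B = rtr (adj K *m K *m fcalc f B).
Proof.
rewrite (@eq_dsum _ _ _ (fun a b => (fun=> 1) a * f b)) => [|i j]; last by rewrite mul1r.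
by rewrite dsum_prod fcalc_cst mulmx1.
Qed.

(** Rectangular [K] is allowed so that a column vector [K], with [B] of size 1, turns joint
    concavity into operator concavity. *)
Definition jconc h : Prop :=
  forall m n (K : 'M[C]_(m, n)) A1 A2 B1 B2 t,
    pdmx A1 -> pdmx A2 -> pdmx B1 -> pdmx B2 -> 0 <= t <= 1 ->
    t * dsum h K A1 B1 + (1 - t) * dsum h K A2 B2 <=
      dsum h K (mix t A1 A2) (mix t B1 B2).

Lemma eq_jconc h h' : (forall a b, 0 < a -> 0 < b -> h a b = h' a b) ->
  jconc h -> jconc h'.
Proof.
move=> e hc m n K A1 A2 B1 B2 t pA1 pA2 pB1 pB2 t01.
have := hc _ _ K _ _ _ _ _ pA1 pA2 pB1 pB2 t01.
rewrite (eq_dsum_pd K pA1 pB1 e) (eq_dsum_pd K pA2 pB2 e).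
by rewrite (eq_dsum_pd K (pdmx_mix t01 pA1 pA2) (pdmx_mix t01 pB1 pB2) e).
Qed.

Lemma jconcD h h' : jconc h -> jconc h' -> jconc (fun a b => h a b + h' a b).
Proof.
move=> hc hc' m n K A1 A2 B1 B2 t pA1 pA2 pB1 pB2 t01; rewrite !dsumD.
have := hc _ _ K _ _ _ _ _ pA1 pA2 pB1 pB2 t01.
have := hc' _ _ K _ _ _ _ _ pA1 pA2 pB1 pB2 t01.
by lra.
Qed.

Lemma jconcZ c h : 0 <= c -> jconc h -> jconc (fun a b => c * h a b).
Proof.
move=> c0 hc m n K A1 A2 B1 B2 t pA1 pA2 pB1 pB2 t01; rewrite !dsumZ.
have := hc _ _ K _ _ _ _ _ pA1 pA2 pB1 pB2 t01.
by move/(ler_wpM2l c0); rewrite mulrDr !(mulrCA c).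
Qed.

(** The form is linear in [A], hence concave for either sign of [c]; c = -1 supplies the concavity
    of [- l] asked for by [jconc_sqr_div]. *)
Lemma jconc_fst c : jconc (fun a _ => c * a).
Proof.
move=> m n K A1 A2 B1 B2 t pA1 pA2 pB1 pB2 t01.
have pA := pdmx_mix t01 pA1 pA2.
rewrite !dsumZ !(dsum_fst id) !fcalc_id; try exact: pdmx_selfadj.
rewrite /mix mulmxDr mulmxDl rtrD -!scalemxAr -!scalemxAl !rtrZ.
by lra.
Qed.

Lemma jconc_snd c : jconc (fun _ b => c * b).
Proof.
move=> m n K A1 A2 B1 B2 t pA1 pA2 pB1 pB2 t01.
have pB := pdmx_mix t01 pB1 pB2.
rewrite !dsumZ !(dsum_snd id) !fcalc_id; try exact: pdmx_selfadj.
rewrite /mix mulmxDr rtrD -!scalemxAr !rtrZ.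
by lra.
Qed.

(** Entries in the eigenbases of [A] and [B] can be prescribed freely; this provides the minimizer
    in the infimum behind parallel sums. *)
Lemma schur_multiplier m n (K : 'M[C]_(m, n)) A B (g : 'I_m -> 'I_n -> R) :
  exists X : 'M[C]_(m, n), forall i j,
    (U A *m X *m adj (U B)) i j = (g i j)%:C * (U A *m K *m adj (U B)) i j.
Proof.
exists (adj (U A) *m (\matrix_(i, j) ((g i j)%:C * (U A *m K *m adj (U B)) i j)) *m U B).
by move=> i j; rewrite !mulmxA spectralV mul1mx -mulmxA spectralV mulmx1 mxE.
Qed.

(** After multiplication by p + q, the gap between the two sides is the square |(p + q) x - q
    k|^2. *)
Lemma nsq_parallel (k x : C) (p q : R) : 0 < p -> 0 < q ->
  nsq k * (p * q / (p + q)) <= nsq x * p + nsq (k - x) * q.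
Proof.
move=> p0 q0; case: k x => k1 k2 [x1 x2]; rewrite /nsq /=.
rewrite mulrA ler_pdivrMr ?addr_gt0 // -subr_ge0.
rewrite (_ : _ - _ = ((p + q) * x1 - q * k1) ^+ 2 + ((p + q) * x2 - q * k2) ^+ 2).
  by rewrite addr_ge0 ?sqr_ge0.
by ring.
Qed.

(** This [x] annihilates the square that separates the two sides in [nsq_parallel]. *)
Lemma nsq_parallel_eq (k : C) (p q : R) : 0 < p -> 0 < q ->
  let x := (q / (p + q))%:C * k in
  nsq k * (p * q / (p + q)) = nsq x * p + nsq (k - x) * q.
Proof.
move=> p0 q0 x.
have -> : k - x = (p / (p + q))%:C * k.
  rewrite /x -{1}(mul1r k) -mulrBl; congr (_ * _).
  rewrite -(rmorph1 (real_complex R)) -rmorphB; congr _%:C.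
  by field; rewrite gt_eqF ?addr_gt0.
by rewrite !nsqM; field; rewrite gt_eqF ?addr_gt0.
Qed.

Lemma sandwichB m n (P : 'M[C]_m) (Q : 'M[C]_n) (K X : 'M[C]_(m, n)) i j :
  (P *m (K - X) *m Q) i j = (P *m K *m Q) i j - (P *m X *m Q) i j.
Proof. by rewrite mulmxBr mulmxBl; rewrite [LHS]mxE; congr (_ + _); rewrite [LHS]mxE. Qed.

(* The parallel sum is the infimal convolution of quadratic forms, and an
   infimum over [X] of jointly concave functions of [(A, B)] is concave. *)
Lemma jconc_parallel h1 h2 :
  (forall a b, 0 < a -> 0 < b -> 0 < h1 a b) ->
  (forall a b, 0 < a -> 0 < b -> 0 < h2 a b) ->
  jconc h1 -> jconc h2 ->
  jconc (fun a b => h1 a b * h2 a b / (h1 a b + h2 a b)).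
Proof.
move=> h1p h2p c1 c2 m n K A1 A2 B1 B2 t pA1 pA2 pB1 pB2 t01.
have pA := pdmx_mix t01 pA1 pA2; have pB := pdmx_mix t01 pB1 pB2.
have upper (X : 'M[C]_(m, n)) A B : pdmx A -> pdmx B ->
    dsum (fun a b => h1 a b * h2 a b / (h1 a b + h2 a b)) K A B <=
    dsum h1 X A B + dsum h2 (K - X) A B.
  move=> hA hB; rewrite /dsum -big_split; apply: ler_sum => i _.
  rewrite -big_split; apply: ler_sum => j _ /=.
  rewrite sandwichB.
  by apply: nsq_parallel; [apply: h1p | apply: h2p]; apply: eigv_gt0.
set A := mix t A1 A2 in pA *; set B := mix t B1 B2 in pB *.
pose p i j := h1 (eigv A i) (eigv B j); pose q i j := h2 (eigv A i) (eigv B j).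
have [X hX] := schur_multiplier K A B (fun i j => q i j / (p i j + q i j)).
have -> : dsum (fun a b => h1 a b * h2 a b / (h1 a b + h2 a b)) K A B =
    dsum h1 X A B + dsum h2 (K - X) A B.
  rewrite /dsum -big_split; apply: eq_bigr => i _.
  rewrite -big_split; apply: eq_bigr => j _ /=.
  rewrite sandwichB hX.
  by apply: nsq_parallel_eq; [apply: h1p | apply: h2p]; apply: eigv_gt0.
have := c1 _ _ X _ _ _ _ _ pA1 pA2 pB1 pB2 t01.
have := c2 _ _ (K - X) _ _ _ _ _ pA1 pA2 pB1 pB2 t01.
have := upper X _ _ pA1 pB1; have := upper X _ _ pA2 pB2.
move: t01 => /andP[t0 t1] u2 u1; rewrite -/A -/B => l2 l1.
apply: le_trans (lerD l1 l2).
have := ler_wpM2l t0 u1; have : 0 <= 1 - t by lra.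
by move=> /ler_wpM2l/(_ _ _ u2); lra.
Qed.

Local Open Scope classical_set_scope.

Lemma cvgr_sum (I : Type) (r : seq I) (u_ : I -> nat -> R) (u : I -> R) :
  (forall i, u_ i k @[k --> \oo] --> u i) ->
  \sum_(i <- r) u_ i k @[k --> \oo] --> \sum_(i <- r) u i.
Proof.
move=> hu; elim: r => [|i r IH].
  by rewrite big_nil; under eq_fun do rewrite big_nil; exact: cvg_cst.
by rewrite big_cons; under eq_fun do rewrite big_cons; exact: cvgD.
Qed.

(** At fixed matrices the form is a finite sum of kernel values at positive eigenvalues, so
    pointwise convergence carries the inequality to the limit. *)
Lemma jconc_lim (h_ : nat -> R -> R -> R) h :
  (forall a b, 0 < a -> 0 < b -> h_ n a b @[n --> \oo] --> h a b) ->
  (forall n, jconc (h_ n)) -> jconc h.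
Proof.
move=> hl hc m n K A1 A2 B1 B2 t pA1 pA2 pB1 pB2 t01.
have dl A B : pdmx A -> pdmx B -> dsum (h_ k) K A B @[k --> \oo] --> dsum h K A B.
  move=> pA pB; apply: cvgr_sum => i; apply: cvgr_sum => j.
  by apply: cvgM; [exact: cvg_cst|apply: hl; apply: eigv_gt0].
apply: (ler_cvg_to (cvgD (cvgM (cvg_cst t) (dl _ _ pA1 pB1))
  (cvgM (cvg_cst (1 - t)) (dl _ _ pA2 pB2)))
  (dl _ _ (pdmx_mix t01 pA1 pA2) (pdmx_mix t01 pB1 pB2))).
by apply: nearW => k; apply: hc.
Qed.

End Kernels.

(** * Geometric means, Lieb's concavity, Ando's convexity and the logarithmic kernel *)

Section PowerKernels.
Variable R : realType.
Implicit Types h : R -> R -> R.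
Local Open Scope classical_set_scope.

(** Iterated arithmetic and harmonic means, the latter as twice a parallel sum. Their product stays
    x y, so the limit is the geometric mean. *)
Definition ahm (x y : R) n : R * R :=
  iter n (fun p => ((p.1 + p.2) / 2, 2 * (p.1 * p.2 / (p.1 + p.2)))) (x, y).

Lemma ahm_gt0 (x y : R) n : 0 < x -> 0 < y -> 0 < (ahm x y n).1 /\ 0 < (ahm x y n).2.
Proof.
move=> x0 y0; elim: n => //= n [u0 v0].
split; first by apply: divr_gt0; rewrite ?addr_gt0 ?ltr0n.
by apply: mulr_gt0; [rewrite ltr0n | apply: divr_gt0; [exact: mulr_gt0 | exact: addr_gt0]].
Qed.

Lemma ahm_prod (x y : R) n : 0 < x -> 0 < y -> (ahm x y n).1 * (ahm x y n).2 = x * y.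
Proof.
move=> x0 y0; elim: n => //= n <-; have [u0 v0] := ahm_gt0 n x0 y0.
by field; rewrite gt_eqF // addr_gt0.
Qed.

(** Since the two components multiply to x y, the first one follows Newton's iteration for the
    square root of x y: at the value u, an error e becomes e^2 / (2 u). *)
Lemma ahm_step (x y : R) n : 0 < x -> 0 < y ->
  (ahm x y n.+1).1 - Num.sqrt (x * y) =
  ((ahm x y n).1 - Num.sqrt (x * y)) ^+ 2 / (2 * (ahm x y n).1).
Proof.
move=> x0 y0; have [u0 v0] := ahm_gt0 n x0 y0.
rewrite sqrrB sqr_sqrtr; last by rewrite mulr_ge0 // ltW.
rewrite -{3}(ahm_prod n x0 y0) /=.
by field; rewrite gt_eqF.
Qed.

(** The new error e^2 / (2 u) is nonnegative, and at most e / 2 once 0 <= e <= u. Indices start at 1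
    because [x] itself may lie below the square root. *)
Lemma ahm_bound (x y : R) n : 0 < x -> 0 < y ->
  0 <= (ahm x y n.+1).1 - Num.sqrt (x * y) <= (ahm x y 1).1 * 2^-1 ^+ n.
Proof.
move=> x0 y0; elim: n => [|n /andP[l u]].
  rewrite expr0 mulr1 gerBl sqrtr_ge0 andbT ahm_step //.
  by rewrite divr_ge0 ?sqr_ge0 // mulr_ge0 // ltW //; case: (ahm_gt0 0 x0 y0).
rewrite ahm_step //; have [u0 v0] := ahm_gt0 n.+1 x0 y0.
apply/andP; split.
  by rewrite divr_ge0 ?sqr_ge0 // mulr_ge0 // ltW.
move: l u u0; set u := (ahm x y n.+1).1; set c := (ahm x y 1).1; clearbody u c.
move=> l h u0; rewrite ler_pdivrMr ?mulr_gt0 //.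
have -> : c * 2^-1 ^+ n.+1 * (2 * u) = c * 2^-1 ^+ n * u.
  by rewrite exprS; field.
apply: le_trans (ler_wpM2r (ltW u0) h).
by rewrite expr2 ler_wpM2l // gerBl sqrtr_ge0.
Qed.

Lemma ahm_cvg (x y : R) : 0 < x -> 0 < y ->
  (ahm x y n).1 @[n --> \oo] --> Num.sqrt (x * y).
Proof.
move=> x0 y0; rewrite -(cvg_shiftS (fun n => (ahm x y n).1)).
have hb n := ahm_bound n x0 y0.
have e : (fun n => Num.sqrt (x * y) + (ahm x y 1).1 * 2^-1 ^+ n : R) @ \oo -->
    Num.sqrt (x * y) + (ahm x y 1).1 * 0.
  apply: cvgD; first exact: cvg_cst.
  apply: cvgM; first exact: cvg_cst.
  by apply: cvg_expr; rewrite ltr_norml; lra.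
rewrite mulr0 addr0 in e.
apply: (squeeze_cvgr _ (cvg_cst (Num.sqrt (x * y))) e).
by apply: nearW => n; move: (hb n); rewrite subr_ge0 lerBlDl.
Qed.

Lemma jconc_geomean h1 h2 :
  (forall a b, 0 < a -> 0 < b -> 0 < h1 a b) ->
  (forall a b, 0 < a -> 0 < b -> 0 < h2 a b) ->
  jconc h1 -> jconc h2 -> jconc (fun a b => Num.sqrt (h1 a b * h2 a b)).
Proof.
move=> p1 p2 c1 c2.
apply: (@jconc_lim _ (fun n a b => (ahm (h1 a b) (h2 a b) n).1)) => [a b a0 b0|n].
  by apply: ahm_cvg; [apply: p1 | apply: p2].
(* Each mean involves both components, so the induction carries both. *)
suff [] : jconc (fun a b => (ahm (h1 a b) (h2 a b) n).1) /\
          jconc (fun a b => (ahm (h1 a b) (h2 a b) n).2) by [].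
elim: n => [|n [IH1 IH2]]; first by split.
split.
  have /= := jconcZ (_ : 0 <= 2^-1) (jconcD IH1 IH2).
  rewrite invr_ge0 ler0n => /(_ isT); apply: eq_jconc => a b a0 b0 /=.
  by rewrite mulrC.
apply: jconcZ => //; apply: jconc_parallel => // a b a0 b0.
  by case: (ahm_gt0 n (p1 _ _ a0 b0) (p2 _ _ a0 b0)).
by case: (ahm_gt0 n (p1 _ _ a0 b0) (p2 _ _ a0 b0)).
Qed.

Let geo (s a b : R) := expR (s * ln a + (1 - s) * ln b).

Let jconc_geo0 : jconc (geo 0).
Proof.
apply: eq_jconc (jconc_snd 1) => a b a0 b0.
by rewrite /geo mul0r add0r subr0 !mul1r lnK.
Qed.

Let jconc_geo1 : jconc (geo 1).
Proof.
apply: eq_jconc (jconc_fst 1) => a b a0 b0.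
by rewrite /geo subrr mul0r addr0 !mul1r lnK.
Qed.

(** The geometric mean of the kernels with exponents s and t is the kernel with the midpoint
    exponent. *)
Let jconc_geo_mid (s t : R) : jconc (geo s) -> jconc (geo t) -> jconc (geo ((s + t) / 2)).
Proof.
have pos u a b : 0 < a -> 0 < b -> 0 < geo u a b by rewrite /geo expR_gt0.
move=> cs ct; apply: eq_jconc (jconc_geomean (pos s) (pos t) cs ct) => a b a0 b0.
rewrite /geo -expRD.
rewrite (_ : _ + (_ + _) = ((s + t) / 2 * ln a + (1 - (s + t) / 2) * ln b) *+ 2); last by field.
by rewrite -mulr_natl expRM_natl sqrtr_sqr ger0_norm ?expR_ge0.
Qed.

Let jconc_geo_dyadic n k : (k <= 2 ^ n)%N -> jconc (geo (k%:R / 2 ^+ n)).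
Proof.
elim: n k => [|n IH] k.
  by rewrite expn0 expr0 divr1; case: k => [|[|]].
rewrite expnS mul2n => hk.
(* As k is the sum of its two rounded halves, k / 2^(n+1) is the midpoint of two dyadics of level
   n. *)
have e : k%:R / 2 ^+ n.+1 = (k./2%:R / 2 ^+ n + (uphalf k)%:R / 2 ^+ n) / 2 :> R.
  rewrite -mulrDl -natrD addnC uphalf_half -addnA addnn odd_double_half exprS.
  by field; rewrite expf_neq0 ?pnatr_eq0.
rewrite e; apply: jconc_geo_mid; apply: IH.
  by rewrite leq_half_double (leq_trans hk).
by rewrite leq_uphalf_double.
Qed.

Let jconc_geo (s : R) : 0 <= s <= 1 -> jconc (geo s).
Proof.
move=> /andP[s0 s1].
(* Rounding down gives dyadics with s - 2^-n < k_n / 2^n <= s. *)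
pose k n := Num.truncn (s * 2 ^+ n).
have kP n : (k n)%:R <= s * 2 ^+ n < (k n).+1%:R.
  by apply: truncn_itv; rewrite mulr_ge0 // exprn_ge0.
apply: (@jconc_lim _ (fun n => geo ((k n)%:R / 2 ^+ n))) => [a b a0 b0|n]; last first.
  apply: jconc_geo_dyadic; rewrite -(ler_nat R) natrX.
  have /andP[h _] := kP n; apply: le_trans h _.
  by rewrite ler_piMl // exprn_ge0.
have hs : (k n)%:R / 2 ^+ n @[n --> \oo] --> s.
  have e : (fun n => s - 2^-1 ^+ n : R) @ \oo --> s - 0.
    apply: cvgB; first exact: cvg_cst.
    by apply: cvg_expr; rewrite ltr_norml; lra.
  rewrite subr0 in e.
  apply: (squeeze_cvgr _ e (cvg_cst s)); apply: nearW => n /=.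
  have p2 : 0 < 2 ^+ n :> R by rewrite exprn_gt0.
  have /andP[h1 h2] := kP n.
  rewrite ler_pdivrMr // h1 andbT ler_pdivlMr // mulrBl -exprMn mulVf ?pnatr_eq0 // expr1n.
  by move: h2; rewrite -natr1; lra.
apply: (@continuous_cvg _ _ _ _ _ _ expR); first exact: continuous_expR.
apply: cvgD; apply: cvgM; try exact: cvg_cst; first exact: hs.
by apply: cvgB; [exact: cvg_cst | exact: hs].
Qed.

Lemma powRE (a s : R) : 0 < a -> a `^ s = expR (s * ln a).
Proof. by move=> a0; rewrite /powR gt_eqF. Qed.

Lemma jconc_powR (s : R) : 0 <= s <= 1 -> jconc (fun a b : R => a `^ s * b `^ (1 - s)).
Proof.
move=> /jconc_geo; apply: eq_jconc => a b a0 b0.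
by rewrite !powRE // /geo expRD.
Qed.

(* [- c l^2 / (l + c h)] is [c] times the parallel sum of [l] and [c h], minus
   [c l]; let [c] tend to infinity. *)
Lemma jconc_sqr_div l h :
  (forall a b, 0 < a -> 0 < b -> 0 < l a b) ->
  (forall a b, 0 < a -> 0 < b -> 0 < h a b) ->
  jconc l -> jconc (fun a b => - l a b) -> jconc h ->
  jconc (fun a b => - (l a b ^+ 2 / h a b)).
Proof.
move=> lp hp cl cnl ch.
apply: (@jconc_lim _ (fun n a b => - (l a b ^+ 2 / (l a b * n.+1%:R^-1 + h a b)))).
  move=> a b a0 b0; apply: cvgN; apply: cvgM; first exact: cvg_cst.
  apply: cvgV; first by rewrite gt_eqF // hp.
  have e : l a b * n.+1%:R^-1 + h a b @[n --> \oo] --> l a b * 0 + h a b.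
    apply: cvgD; last exact: cvg_cst.
    by apply: cvgM; [exact: cvg_cst | exact: cvg_harmonic].
  by rewrite mulr0 add0r in e.
move=> n; have c0 : 0 < n.+1%:R :> R by [].
have hcp a b : 0 < a -> 0 < b -> 0 < n.+1%:R * h a b.
  by move=> a0 b0; rewrite mulr_gt0 // hp.
have := jconcZ (ltW c0) (jconcD (jconc_parallel lp hcp cl (jconcZ (ltW c0) ch)) cnl).
apply: eq_jconc => a b a0 b0.
have l0 := lp _ _ a0 b0; have h0 := hp _ _ a0 b0.
have c1 : 0 < 1 + n%:R :> R by rewrite addrC natr1.
by field; rewrite (gt_eqF c1) gt_eqF // addr_gt0 // mulr_gt0.
Qed.

(** The kernel a^s b^(1-s) equals l^2 / h, with l = b and h = a^(-s) b^(1+s) on [-1, 0], and with l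
    = a and h = a^(2-s) b^(s-1) on [1, 2]. In both cases h falls under Lieb's theorem. *)
Lemma jconcN_powR (s : R) : -1 <= s <= 0 \/ 1 <= s <= 2 ->
  jconc (fun a b : R => - (a `^ s * b `^ (1 - s))).
Proof.
case=> hs.
  have hu : 0 <= - s <= 1 by lra.
  have p (a b : R) : 0 < a -> 0 < b -> 0 < a `^ (- s) * b `^ (1 - - s).
    by move=> a0 b0; rewrite mulr_gt0 // powR_gt0.
  have := jconc_sqr_div (l := fun _ b => b) _ p _ _ (jconc_powR hu).
  move=> /(_ _ _ _)-H; apply: eq_jconc (H _ _ _) => [a b a0 b0|//||].
  - rewrite !powRE // -{1}(lnK b0) -expRM_natl -expRD -expRB -expRD.
    by congr (- expR _); ring.
  - by apply: eq_jconc (jconc_snd 1) => a b _ _; rewrite mul1r.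
  - by apply: eq_jconc (jconc_snd (-1)) => a b _ _; rewrite mulN1r.
have hu : 0 <= 2 - s <= 1 by lra.
have p (a b : R) : 0 < a -> 0 < b -> 0 < a `^ (2 - s) * b `^ (1 - (2 - s)).
  by move=> a0 b0; rewrite mulr_gt0 // powR_gt0.
have := jconc_sqr_div (l := fun a _ => a) _ p _ _ (jconc_powR hu).
move=> H; apply: eq_jconc (H _ _ _) => [a b a0 b0|//||].
- rewrite !powRE // -{1}(lnK a0) -expRM_natl -expRD -expRB -expRD.
  by congr (- expR _); ring.
- by apply: eq_jconc (jconc_fst 1) => a b _ _; rewrite mul1r.
- by apply: eq_jconc (jconc_fst (-1)) => a b _ _; rewrite mulN1r.
Qed.

(** With x = c / (n+1), the bounds x <= e^x - 1 <= x e^x squeeze the sequence between c and c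
    e^x. *)
Lemma cvg_expR_slope (c : R) :
  n.+1%:R * (expR (n.+1%:R^-1 * c) - 1) @[n --> \oo] --> c.
Proof.
have hc : n.+1%:R^-1 * c @[n --> \oo] --> 0 * c.
  by apply: cvgM; [exact: cvg_harmonic | exact: cvg_cst].
have e : c * expR (n.+1%:R^-1 * c) @[n --> \oo] --> c * expR (0 * c).
  apply: cvgM; first exact: cvg_cst.
  by apply: (@continuous_cvg _ _ _ _ _ _ expR); first exact: continuous_expR.
rewrite mul0r expR0 mulr1 in e.
apply: (squeeze_cvgr _ (cvg_cst c) e); apply: nearW => n.
have n0 : 0 < n.+1%:R :> R by [].
set x := n.+1%:R^-1 * c; have cE : c = n.+1%:R * x by rewrite /x mulrA mulfV ?mul1r ?gt_eqF.
rewrite {1 2}cE -mulrA !ler_pM2l //.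
have := expR_ge1Dx x; have := expR_ge1Dx (- x); rewrite expRN.
have p := expR_gt0 x; rewrite -(ler_pM2l p) mulfV ?gt_eqF // => h1 h2.
by apply/andP; split; lra.
Qed.

(** The kernel is the limit of (a^s b^(1-s) - b) / s at s = 1 / (n+1), and the subtracted term is
    linear. *)
Lemma jconc_ln : jconc (fun a b : R => b * (ln a - ln b)).
Proof.
apply: (@jconc_lim R (fun (n : nat) (a b : R) => n.+1%:R *
   (a `^ n.+1%:R^-1 * b `^ (1 - n.+1%:R^-1) + (-1) * b))) => [a b a0 b0|n].
  under eq_fun => n.
    have -> : n.+1%:R * (a `^ n.+1%:R^-1 * b `^ (1 - n.+1%:R^-1) + -1 * b) =
        b * (n.+1%:R * (expR (n.+1%:R^-1 * (ln a - ln b)) - 1)).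
      have -> : a `^ n.+1%:R^-1 * b `^ (1 - n.+1%:R^-1) =
          b * expR (n.+1%:R^-1 * (ln a - ln b)).
        rewrite !powRE // -[in RHS](lnK b0) -!expRD lnK //.
        by congr expR; ring.
      by ring.
    over.
  by apply: cvgM; [exact: cvg_cst | exact: cvg_expR_slope].
apply: jconcZ => //; apply: jconcD (jconc_snd _).
by apply: jconc_powR; rewrite invr_ge0 ler0n invf_le1 // ler1n.
Qed.

End PowerKernels.

(** * Bernoulli's inequality and the passage from scalar to trace inequalities *)

Section TraceFunctions.
Variable R : realType.
Local Notation C := R[i].

(** With l = ln u and c = u^r, the bounds c (1 + (1-r) l) <= u and c (1 - r l) <= 1, weighted by r
    and 1-r, make the logarithms cancel. *)
Lemma powR_le_tangent1 (r u : R) : 0 <= r <= 1 -> 0 < u ->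
  u `^ r <= 1 + r * (u - 1).
Proof.
move=> /andP[r0 r1] u0; rewrite powRE // -{2}(lnK u0).
set l := ln u; set c := expR (r * l).
have c0 : 0 < c := expR_gt0 _.
have h1 : c * (1 + (1 - r) * l) <= expR l.
  have -> : expR l = c * expR ((1 - r) * l) by rewrite -expRD; congr expR; ring.
  by rewrite ler_pM2l // expR_ge1Dx.
have h2 : c * (1 - r * l) <= 1.
  rewrite [leRHS](_ : 1 = c * expR (- (r * l))); last by rewrite -expRD subrr expR0.
  by rewrite ler_pM2l // expR_ge1Dx.
have := ler_wpM2l r0 h1; have r1' : 0 <= 1 - r by lra.
by have := ler_wpM2l r1' h2; lra.
Qed.

(** With l = ln u: for r <= 0, use u^r >= 1 + r l and l <= u - 1; for r >= 1, use u^r >= u (1 +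
    (r-1) l) and u l >= u - 1. *)
Lemma powR_ge_tangent1 (r u : R) : r <= 0 \/ 1 <= r -> 0 < u ->
  1 + r * (u - 1) <= u `^ r.
Proof.
move=> hr u0; rewrite powRE //; set l := ln u.
have ul : 1 + l <= u by rewrite -{1}(lnK u0); exact: expR_ge1Dx.
case: hr => hr.
  apply: le_trans (expR_ge1Dx _); rewrite lerD2l.
  have h : 0 <= - r by lra.
  by have := ler_wpM2l h ul; lra.
have h1 : u * (1 + (r - 1) * l) <= expR (r * l).
  have -> : expR (r * l) = u * expR ((r - 1) * l).
    by rewrite -{1}(lnK u0) -expRD; congr expR; rewrite /l; ring.
  by rewrite ler_pM2l // expR_ge1Dx.
have h2 : u * (1 - l) <= 1.
  rewrite [leRHS](_ : 1 = u * expR (- l)); last by rewrite -{1}(lnK u0) -expRD subrr expR0.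
  by rewrite ler_pM2l // expR_ge1Dx.
have h : 0 <= r - 1 by lra.
by have := ler_wpM2l h h2; lra.
Qed.

(** At K = 1 a scalar inequality for all pairs of eigenvalues becomes a trace inequality through
    [le_dsum], although [Y] and [B] need not commute. *)
Lemma dsum1_affine n g k (Y B : 'M[C]_n) : selfadj Y ->
  dsum (fun a b => a * g b + k b) 1%:M Y B = rtr (Y *m fcalc g B) + rtr (fcalc k B).
Proof.
move=> hY; rewrite dsumD (dsum_prod id) dsum_snd fcalc_id //.
by rewrite adj_1mx !mul1mx mulmx1.
Qed.

Lemma dsum1_fst n f (Y B : 'M[C]_n) :
  dsum (fun a _ => f a) 1%:M Y B = rtr (fcalc f Y).
Proof. by rewrite dsum_fst adj_1mx mul1mx mulmx1. Qed.

(* If [f y] is the maximum over [b > 0] of [y * g b + k b], then [Tr f(Y)] is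
   the maximum over [B > 0] of [Tr (Y g(B)) + Tr k(B)]; joint concavity of the
   latter passes to the former. *)
Lemma variational_concave n (D : R -> Prop) (f g k beta : R -> R)
    (Y1 Y2 Y : 'M[C]_n) t :
  0 <= t <= 1 -> selfadj Y1 -> selfadj Y2 -> selfadj Y ->
  (forall i, D (eigv Y1 i)) -> (forall i, D (eigv Y2 i)) -> (forall i, D (eigv Y i)) ->
  (forall y b, D y -> 0 < b -> y * g b + k b <= f y) ->
  (forall y, D y -> 0 < beta y /\ f y = y * g (beta y) + k (beta y)) ->
  (forall B1 B2, pdmx B1 -> pdmx B2 ->
    t * (rtr (Y1 *m fcalc g B1) + rtr (fcalc k B1)) +
    (1 - t) * (rtr (Y2 *m fcalc g B2) + rtr (fcalc k B2)) <=
    rtr (Y *m fcalc g (mix t B1 B2)) + rtr (fcalc k (mix t B1 B2))) ->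
  t * rtr (fcalc f Y1) + (1 - t) * rtr (fcalc f Y2) <= rtr (fcalc f Y).
Proof.
move=> t01 h1 h2 h D1 D2 DY fge feq joint.
have pB Z : (forall i, D (eigv Z i)) -> pdmx (fcalc beta Z).
  by move=> DZ; apply: pdmx_fcalc => i; case: (feq _ (DZ i)).
have eqZ Z : selfadj Z -> (forall i, D (eigv Z i)) ->
    rtr (fcalc f Z) = rtr (Z *m fcalc g (fcalc beta Z)) + rtr (fcalc k (fcalc beta Z)).
  move=> hZ DZ; rewrite -rtrD !fcalc_comp -{2}(fcalc_id hZ) fcalcM fcalcD.
  by congr rtr; apply: eq_fcalc => i /=; case: (feq _ (DZ i)).
rewrite (eqZ _ _ h1 D1) (eqZ _ _ h2 D2).
apply: le_trans (joint _ _ (pB _ _ D1) (pB _ _ D2)) _.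
rewrite -dsum1_affine // -(dsum1_fst _ _ (mix t (fcalc beta Y1) (fcalc beta Y2))).
apply: le_dsum => i j; apply: fge => //.
exact: eigv_gt0 (pdmx_mix t01 (pB _ _ D1) (pB _ _ D2)).
Qed.

Lemma rtr_mulmx_mix n t (M A B : 'M[C]_n) :
  rtr (M *m mix t A B) = t * rtr (M *m A) + (1 - t) * rtr (M *m B).
Proof. by rewrite /mix mulmxDr -!scalemxAr rtrD !rtrZ. Qed.

(** Here [d] gives slopes of tangents above [f], so Tr f(Z) <= Tr f(Y) + Tr d(Y)(Z - Y). Averaging
    over Z = Y1, Y2 leaves minus the trace of d(Y) against [Y - mix t Y1 Y2], which the last
    hypothesis signs. *)
Lemma tangent_concave n (D : R -> Prop) (f d : R -> R) (Y1 Y2 Y : 'M[C]_n) t :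
  0 <= t <= 1 -> selfadj Y1 -> selfadj Y2 -> selfadj Y ->
  (forall i, D (eigv Y1 i)) -> (forall i, D (eigv Y2 i)) -> (forall i, D (eigv Y i)) ->
  (forall x y, D x -> D y -> f x <= f y + d y * (x - y)) ->
  (forall i v, 0 <= d (eigv Y i) * qform (Y - mix t Y1 Y2) v) ->
  t * rtr (fcalc f Y1) + (1 - t) * rtr (fcalc f Y2) <= rtr (fcalc f Y).
Proof.
move=> /andP[t0 t1] h1 h2 h D1 D2 DY fle sgn.
have {}t1 : 0 <= 1 - t by lra.
have up Z : selfadj Z -> (forall i, D (eigv Z i)) ->
    rtr (fcalc f Z) <= rtr (Z *m fcalc d Y) + rtr (fcalc (fun y => f y - d y * y) Y).
  move=> hZ DZ; rewrite -dsum1_affine // -(dsum1_fst f Z Y); apply: le_dsum => i j.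
  move: (fle _ _ (DZ i) (DY j)); move: (eigv Z i) (eigv Y j) => a b.
  by lra.
have := up _ h1 D1; have := up _ h2 D2.
have e : rtr (fcalc (fun y => f y - d y * y) Y) = rtr (fcalc f Y) - rtr (fcalc d Y *m Y).
  rewrite -[X in _ *m X](fcalc_id h) fcalcM !rtr_fcalc -sumrB.
  by [].
have : 0 <= rtr (fcalc d Y *m (Y - mix t Y1 Y2)).
  by rewrite fcalc_pair; apply: sumr_ge0 => i _; apply: sgn.
rewrite mulmxBr rtrD rtrN rtr_mulmx_mix e (rtrC Y1) (rtrC Y2).
move: (rtr (fcalc f Y1)) (rtr (fcalc f Y2)) (rtr (fcalc f Y)) => a1 a2 a.
move: (rtr (_ *m Y1)) (rtr (_ *m Y2)) (rtr (_ *m Y)) => b1 b2 b.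
move=> sb /(ler_wpM2l t1) u2 /(ler_wpM2l t0) u1.
by lra.
Qed.

(** This is [tangent_concave] with [Y] the mixture itself, so the matrix to be signed is zero. *)
Lemma trace_concave n (f d : R -> R) (B1 B2 : 'M[C]_n) t :
  0 <= t <= 1 -> pdmx B1 -> pdmx B2 ->
  (forall x y, 0 < x -> 0 < y -> f x <= f y + d y * (x - y)) ->
  t * rtr (fcalc f B1) + (1 - t) * rtr (fcalc f B2) <= rtr (fcalc f (mix t B1 B2)).
Proof.
move=> t01 p1 p2 fle; have p := pdmx_mix t01 p1 p2.
apply: (@tangent_concave _ (fun x => 0 < x) f d) => //; try exact: pdmx_selfadj;
  try by move=> i; apply: eigv_gt0.
by move=> i v; rewrite subrr /qform mulmx0 mul0mx mxE mulr0.
Qed.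

Lemma eigv_1 n (i : 'I_n) : eigv (1%:M : 'M[C]_n) i = 1.
Proof.
have := fcalc_id (selfadj1 R n); rewrite fcalcE.
move/(congr1 (fun M => eigbasis 1%:M *m M *m adj (eigbasis 1%:M))).
rewrite /= mulmx1 !mulmxA spectralV mul1mx -mulmxA spectralV mulmx1.
by move/matrixP/(_ i i); rewrite !mxE eqxx => -[].
Qed.

Lemma mix_id n t (A : 'M[C]_n) : mix t A A = A.
Proof. by rewrite /mix -scalerDl -rmorphD addrC subrK rmorph1 scale1r. Qed.

(* Taking [B = 1] (of size 1), a jointly concave kernel [h] makes [h a 1]
   operator concave in the first variable. *)
Lemma jconc_operator h f n (A1 A2 : 'M[C]_n) t v :
  jconc h -> (forall a, 0 < a -> h a 1 = f a) ->
  0 <= t <= 1 -> pdmx A1 -> pdmx A2 ->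
  t * qform (fcalc f A1) v + (1 - t) * qform (fcalc f A2) v <=
  qform (fcalc f (mix t A1 A2)) v.
Proof.
move=> hc hf t01 p1 p2.
have e A : pdmx A -> qform (fcalc f A) v = dsum h v A (1%:M : 'M[C]_1).
  move=> pA; rewrite (@eq_dsum _ _ _ _ (fun a _ => f a)) => [|i j].
    by rewrite dsum_fst /rtr /mxtrace big_ord1.
  by rewrite eigv_1 hf // eigv_gt0.
rewrite (e _ p1) (e _ p2) (e _ (pdmx_mix t01 p1 p2)).
rewrite -{3}(mix_id t 1%:M).
by apply: hc => //; apply: pdmx1.
Qed.

End TraceFunctions.

(** * Concavity of Tr c Y(A)^r by the variational formula or by tangents *)

Section PowerTraces.
Variables (R : realType) (n : nat).
Local Notation C := R[i].
Local Notation pw s := (fun x : R => x `^ s).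
Variables M H : 'M[C]_n.

Lemma powRB1 (r x : R) : 0 < x -> x `^ (r - 1) = x `^ r / x.
Proof. by move=> x0; rewrite powRB ?powRr1 ?(ltW x0) // (gt_eqF x0) implybT. Qed.

Lemma powR_div (r x y : R) : 0 < x -> 0 < y -> (x / y) `^ r = x `^ r / y `^ r.
Proof.
move=> x0 y0; rewrite powRM ?invr_ge0 ?(ltW x0) ?(ltW y0) // -(powR_inv1 (ltW y0)).
by rewrite powRAC powR_inv1 // powR_ge0.
Qed.

Definition powY (s : R) (A : 'M[C]_n) : 'M[C]_n :=
  adj M *m M + adj H *m fcalc (pw s) A *m H.

Lemma selfadj_powY s A : selfadj (powY s A).
Proof.
apply: selfadjD; last by apply: selfadj_conj; exact: selfadj_fcalc.
by rewrite -{2}(mul1mx M) mulmxA; apply: selfadj_conj; exact: selfadj1.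
Qed.

(** The constant M^* M counts as M^* 1^s M, so both terms of Y(A) yield the same kernel. *)
Lemma rtr_powY (c s : R) A B :
  rtr (powY s A *m fcalc (fun b => c * b `^ (1 - s)) B) =
  dsum (fun a b : R => c * (a `^ s * b `^ (1 - s))) M 1%:M B +
  dsum (fun a b : R => c * (a `^ s * b `^ (1 - s))) H A B.
Proof.
have d K A' : dsum (fun a b : R => c * (a `^ s * b `^ (1 - s))) K A' B =
    rtr (adj K *m fcalc (pw s) A' *m K *m fcalc (fun b => c * b `^ (1 - s)) B).
  rewrite -(dsum_prod (pw s) (fun b => c * b `^ (1 - s))).
  by apply: eq_dsum => i j; rewrite mulrCA.
by rewrite !d fcalc1 powR1 mulmx1 /powY mulmxDl rtrD.
Qed.

Lemma qform_mix (t : R) (A B : 'M[C]_n) v :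
  qform (mix t A B) v = t * qform A v + (1 - t) * qform B v.
Proof. by rewrite qformD !qformZ. Qed.

Lemma qform_sub_mix (t : R) (Y A B : 'M[C]_n) v :
  qform (Y - mix t A B) v = qform Y v - (t * qform A v + (1 - t) * qform B v).
Proof. by rewrite qformD qformN qform_mix. Qed.

(** The common term x, contributed by the constant part of [powY] or [logX], cancels because the
    weights add up to 1. *)
Lemma qform_sub_mix_shift (t x z z1 z2 : R) (Y A B : 'M[C]_n) v :
  qform Y v = x + z -> qform A v = x + z1 -> qform B v = x + z2 ->
  qform (Y - mix t A B) v = z - (t * z1 + (1 - t) * z2).
Proof. by rewrite qform_sub_mix => -> -> ->; ring. Qed.

Lemma qform_powY_sub (s t : R) A1 A2 A v :
  qform (powY s A - mix t (powY s A1) (powY s A2)) v =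
  qform (fcalc (pw s) A) (H *m v) -
  (t * qform (fcalc (pw s) A1) (H *m v) +
   (1 - t) * qform (fcalc (pw s) A2) (H *m v)).
Proof.
have eY B : qform (powY s B) v = qform (adj M *m M) v + qform (fcalc (pw s) B) (H *m v).
  by rewrite /powY qformD qform_conj.
exact: qform_sub_mix_shift (eY A) (eY A1) (eY A2).
Qed.

(** Taking c = 1 or c = -1 treats maxima and minima together. The three analytic hypotheses say that
    c y^r lies above its tangents, that the coupling of A and B is jointly concave, and that c (1-r)
    b^e lies below its tangents. *)
Lemma tr_powY_joint (c s r t : R) A1 A2 :
  0 <= t <= 1 -> pdmx A1 -> pdmx A2 ->
  (forall A, pdmx A -> pdmx (powY s A)) -> s != 1 -> r != 1 ->
  (forall u, 0 < u -> c * (1 + r * (u - 1)) <= c * u `^ r) ->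
  jconc (fun a b : R => c * r * (a `^ s * b `^ (1 - s))) ->
  (forall u, 0 < u -> c * (1 - r) * u `^ (r * (1 - s) / (r - 1)) <=
     c * (1 - r) * (1 + r * (1 - s) / (r - 1) * (u - 1))) ->
  t * rtr (fcalc (fun y => c * y `^ r) (powY s A1)) +
  (1 - t) * rtr (fcalc (fun y => c * y `^ r) (powY s A2)) <=
  rtr (fcalc (fun y => c * y `^ r) (powY s (mix t A1 A2))).
Proof.
move=> t01 p1 p2 pY s1 r1 bern hK bernk.
have p := pdmx_mix t01 p1 p2.
set e := r * (1 - s) / (r - 1) in bernk *.
have s1' : 1 - s != 0 by rewrite subr_eq0 eq_sym.
have r1' : r - 1 != 0 by rewrite subr_eq0.
apply: (@variational_concave _ _ (fun y => 0 < y) _ (fun b => c * r * b `^ (1 - s))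
  (fun b => c * (1 - r) * b `^ e) (pw ((r - 1) / (1 - s)))) => //;
  try exact: selfadj_powY; try by move=> i; apply: eigv_gt0; apply: pY.
- move=> y b y0 b0.
  (* This z is the point of tangency belonging to [b]; Bernoulli at y / z, scaled by z^r, is the
     tangent inequality there. *)
  set z := b `^ ((1 - s) / (r - 1)); have z0 : 0 < z by exact: powR_gt0.
  have zr : z `^ r = b `^ e by rewrite /z -powRrM; congr (_ `^ _); rewrite /e; field.
  have zr1 : b `^ (1 - s) = z `^ r / z.
    rewrite -(powRB1 _ z0) /z -powRrM.
    by congr (_ `^ _); field.
  have := bern (y / z) (divr_gt0 y0 z0).
  rewrite powR_div //.
  have w0 : 0 < z `^ r by exact: powR_gt0.
  rewrite -(ler_pM2r w0) mulrA mulfVK ?gt_eqF // => h.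
  apply: le_trans h; rewrite zr1 -zr le_eqVlt; apply/orP; left; apply/eqP.
  by field; rewrite gt_eqF.
- move=> y y0; split; first exact: powR_gt0.
  have -> : (y `^ ((r - 1) / (1 - s))) `^ (1 - s) = y `^ r / y.
    rewrite -(powRB1 _ y0) -powRrM.
    by congr (_ `^ _); field.
  have -> : (y `^ ((r - 1) / (1 - s))) `^ e = y `^ r.
    by rewrite -powRrM; congr (_ `^ _); rewrite /e; field; rewrite s1' r1'.
  by field; rewrite gt_eqF.
move=> B1 B2 q1 q2; rewrite !rtr_powY.
have := hK _ _ H _ _ _ _ _ p1 p2 q1 q2 t01.
have := hK _ _ M _ _ _ _ _ (pdmx1 R n) (pdmx1 R n) q1 q2 t01.
have : t * rtr (fcalc (fun b => c * (1 - r) * b `^ e) B1) +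
   (1 - t) * rtr (fcalc (fun b => c * (1 - r) * b `^ e) B2) <=
   rtr (fcalc (fun b => c * (1 - r) * b `^ e) (mix t B1 B2)).
  apply: (@trace_concave _ _ _ (fun y => c * (1 - r) * e * (y `^ e / y))) => // x y x0 y0.
  have := bernk (x / y) (divr_gt0 x0 y0).
  rewrite powR_div //.
  have w0 : 0 < y `^ e by exact: powR_gt0.
  rewrite -(ler_pM2r w0) mulrA mulfVK ?gt_eqF // => h.
  apply: le_trans h _; rewrite le_eqVlt; apply/orP; left; apply/eqP.
  by field; rewrite gt_eqF.
rewrite mix_id.
move: (rtr _) (rtr _) (rtr _) => k1 k2 k3.
move: (dsum _ _ _ _) (dsum _ _ _ _) (dsum _ _ _ _) => m1 m2 m3.
move: (dsum _ _ _ _) (dsum _ _ _ _) (dsum _ _ _ _) => h1 h2 h3.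
by lra.
Qed.

(** The slope of c y^r is c r times a positive number, so the sign condition of [tangent_concave] is
    the operator concavity of c r A^s, that is [hK] at b = 1. *)
Lemma tr_powY_single (c s r t : R) A1 A2 :
  0 <= t <= 1 -> pdmx A1 -> pdmx A2 ->
  (forall A, pdmx A -> pdmx (powY s A)) ->
  (forall u, 0 < u -> c * u `^ r <= c * (1 + r * (u - 1))) ->
  jconc (fun a b : R => c * r * (a `^ s * b `^ (1 - s))) ->
  t * rtr (fcalc (fun y => c * y `^ r) (powY s A1)) +
  (1 - t) * rtr (fcalc (fun y => c * y `^ r) (powY s A2)) <=
  rtr (fcalc (fun y => c * y `^ r) (powY s (mix t A1 A2))).
Proof.
move=> t01 p1 p2 pY bern hK.
have p := pdmx_mix t01 p1 p2.
apply: (@tangent_concave _ _ (fun y => 0 < y) _ (fun y => c * r * (y `^ r / y))) => //;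
  try exact: selfadj_powY; try by move=> i; apply: eigv_gt0; apply: pY.
  move=> x y x0 y0.
  have := bern (x / y) (divr_gt0 x0 y0).
  rewrite powR_div //.
  have w0 : 0 < y `^ r by exact: powR_gt0.
  rewrite -(ler_pM2r w0) mulrA mulfVK ?gt_eqF // => h.
  apply: le_trans h _; rewrite le_eqVlt; apply/orP; left; apply/eqP.
  by field; rewrite gt_eqF.
move=> i v; have := eigv_gt0 i (pY _ p); move: (eigv _ i) => y y0.
rewrite qform_powY_sub mulrAC mulr_ge0 //.
  have hf a : 0 < a -> c * r * (a `^ s * 1 `^ (1 - s)) = c * r * a `^ s.
    by rewrite powR1 mulr1.
  have := jconc_operator (H *m v) hK hf t01 p1 p2.
  rewrite -!fcalcZ !qformZ.
  move: (qform _ _) (qform _ _) (qform _ _) => a b d.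
  by lra.
by rewrite divr_ge0 ?powR_ge0 // ltW.
Qed.

End PowerTraces.

(** * Traces of exponentials, for the case p = 1 *)

Section LogTraces.
Variables (R : realType) (n : nat).
Local Notation C := R[i].
Variables L H : 'M[C]_n.
Hypothesis hL : selfadj L.

Definition logX (A : 'M[C]_n) : 'M[C]_n := L + adj H *m fcalc (@ln R) A *m H.

Lemma selfadj_logX A : selfadj (logX A).
Proof. by apply: selfadjD => //; apply: selfadj_conj; exact: selfadj_fcalc. Qed.

Local Notation xlnx := (fun b : R => b * ln b).
Local Notation relent := (fun a b : R => b * (ln a - ln b)).

(** At K = 1 this is minus the relative entropy Tr B (ln B - ln A). *)
Lemma dsum_relent (K A B : 'M[C]_n) : selfadj B ->
  dsum relent K A B =
  rtr (adj K *m fcalc (@ln R) A *m K *m B) - rtr (adj K *m K *m fcalc xlnx B).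
Proof.
move=> hB; rewrite -{2}(fcalc_id hB) -(dsum_prod (@ln R) id)
  -(dsum_snd _ _ A) -mulN1r -dsumZ -dsumD.
by apply: eq_dsum => i j /=; rewrite mulN1r mulrBr (mulrC (eigv B j) (ln (eigv A i))).
Qed.

Lemma fcalc_ln1 : fcalc (@ln R) (1%:M : 'M[C]_n) = 0.
Proof. by rewrite fcalc1 ln1 (rmorph0 (real_complex R)) raddf0. Qed.

(** As ln 1 = 0 and M^* M + H^* H = 1, the two kernel sums together absorb the share q of the
    entropy term Tr B ln B; the share 1 - q stays outside. *)
Lemma rtr_logX (q : R) (M A B : 'M[C]_n) : adj M *m M = 1%:M - adj H *m H ->
  selfadj B ->
  rtr (logX A *m fcalc (fun b => q * b) B) + rtr (fcalc (fun b => b - xlnx b) B) =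
  q * (rtr (L *m B) + dsum relent H A B + dsum relent M 1%:M B) +
  rtr (fcalc (fun b => b - (1 - q) * xlnx b) B).
Proof.
move=> hM hB; rewrite !dsum_relent // hM fcalc_ln1 mulmx0 !mul0mx.
rewrite mulmxBl mul1mx /logX -(fcalcZ q id) fcalc_id // -scalemxAr rtrZ mulmxDl.
have -> : fcalc (fun b => b - xlnx b) B = B - fcalc xlnx B.
  rewrite -[X in _ = X - _](fcalc_id hB) -scaleN1r -(rmorph1 (real_complex R)) -rmorphN.
  by rewrite fcalcZ fcalcD; apply: eq_fcalc => i; rewrite mulN1r.
have -> : fcalc (fun b => b - (1 - q) * xlnx b) B = B + (- (1 - q))%:C *: fcalc xlnx B.
  rewrite -[X in _ = X + _](fcalc_id hB) fcalcZ fcalcD.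
  by apply: eq_fcalc => i; rewrite mulNr.
rewrite !rtrD !rtrN rtrZ.
have -> : rtr (0 : 'M[C]_n) = 0 by rewrite /rtr mxtrace0.
move: (rtr _) (rtr _) (rtr _) (rtr _) (rtr _) => x1 x2 x3 x4 x5.
by ring.
Qed.

(** Multiply 1 + z <= e^z by x at z = ln y - ln x. *)
Lemma xlnx_tangent (q x y : R) : q <= 1 -> 0 < x -> 0 < y ->
  x - (1 - q) * xlnx x <=
  y - (1 - q) * xlnx y + (1 - (1 - q) * (1 + ln y)) * (x - y).
Proof.
move=> q1 x0 y0.
have h : x * (1 + (ln y - ln x)) <= y.
  have e : x * expR (ln y - ln x) = y.
    by rewrite expRB !lnK // mulrC divfK ?gt_eqF.
  by rewrite -[leRHS]e ler_pM2l // expR_ge1Dx.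
have q1' : 0 <= 1 - q by lra.
by have := ler_wpM2l q1' h; lra.
Qed.

(** Gibbs' variational principle: e^(q x) is the maximum over b > 0 of q x b + b - b ln b, reached
    at b = e^(q x). The kernels enter with weight q >= 0 and the remaining entropy with 1 - q >=
    0. *)
Lemma tr_logX_joint (q t : R) (M A1 A2 : 'M[C]_n) :
  adj M *m M = 1%:M - adj H *m H ->
  0 <= t <= 1 -> pdmx A1 -> pdmx A2 -> 0 <= q <= 1 ->
  t * rtr (fcalc (fun x => expR (q * x)) (logX A1)) +
  (1 - t) * rtr (fcalc (fun x => expR (q * x)) (logX A2)) <=
  rtr (fcalc (fun x => expR (q * x)) (logX (mix t A1 A2))).
Proof.
move=> hM t01 p1 p2 /andP[q0 q1].
have sX := selfadj_logX.
apply: (@variational_concave _ _ (fun=> True) _ (fun b => q * b)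
  (fun b => b - xlnx b) (fun x => expR (q * x)) _ _ _ _ t01 (sX _) (sX _) (sX _)
  (fun=> I) (fun=> I) (fun=> I)).
- move=> y b _ b0.
  have -> : expR (q * y) = b * expR (q * y - ln b).
    by rewrite -{1}(lnK b0) -expRD addrC subrK.
  have := expR_ge1Dx (q * y - ln b); rewrite -(ler_pM2l b0); apply: le_trans.
  by lra.
- by move=> y _; split; [exact: expR_gt0 | rewrite expRK; ring].
move=> B1 B2 q1' q2'; have p := pdmx_mix t01 p1 p2; have qm := pdmx_mix t01 q1' q2'.
rewrite !(rtr_logX q _ hM); try exact: pdmx_selfadj.
have := jconc_ln H p1 p2 q1' q2' t01.
have := jconc_ln M (pdmx1 R n) (pdmx1 R n) q1' q2' t01.
rewrite mix_id rtr_mulmx_mix.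
have := trace_concave t01 q1' q2' (fun x y => @xlnx_tangent q x y q1).
move: (dsum _ _ _ B1) (dsum _ _ _ B2) (dsum _ _ _ (mix t B1 B2)) => m1 m2 m3.
move: (dsum _ _ _ B1) (dsum _ _ _ B2) (dsum _ _ _ (mix t B1 B2)) => h1 h2 h3.
move: (rtr (fcalc _ B1)) (rtr (fcalc _ B2)) (rtr (fcalc _ (mix t B1 B2))) => k1 k2 k3.
move: (rtr _) (rtr _) => l1 l2.
move=> hk /(ler_wpM2l q0) hm /(ler_wpM2l q0) hh.
by lra.
Qed.

(** For q <= 0 the function -e^(q x) is concave and nondecreasing, and ln is operator concave. *)
Lemma tr_logX_single (q t : R) (A1 A2 : 'M[C]_n) :
  0 <= t <= 1 -> pdmx A1 -> pdmx A2 -> q <= 0 ->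
  t * rtr (fcalc (fun x => - expR (q * x)) (logX A1)) +
  (1 - t) * rtr (fcalc (fun x => - expR (q * x)) (logX A2)) <=
  rtr (fcalc (fun x => - expR (q * x)) (logX (mix t A1 A2))).
Proof.
move=> t01 p1 p2 q0; have p := pdmx_mix t01 p1 p2.
have sX := selfadj_logX.
apply: (@tangent_concave _ _ (fun=> True) _ (fun x => - (q * expR (q * x)))
  _ _ _ _ t01 (sX _) (sX _) (sX _) (fun=> I) (fun=> I) (fun=> I)).
  move=> x y _ _.
  have -> : expR (q * x) = expR (q * y) * expR (q * x - q * y).
    by rewrite -expRD addrC subrK.
  have := expR_ge1Dx (q * x - q * y); rewrite -(ler_pM2l (expR_gt0 (q * y))).
  by lra.
move=> i v; move: (eigv _ i) => y.
have eX B : qform (logX B) v = qform L v + qform (fcalc (@ln R) B) (H *m v).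
  by rewrite /logX qformD qform_conj.
rewrite (qform_sub_mix_shift t (eX _) (eX A1) (eX A2)) -mulNr mulr_ge0 //.
  by rewrite mulr_ge0 ?expR_ge0 // oppr_ge0.
have hf a : 0 < a -> 1 * (ln a - ln 1) = ln a :> R by rewrite ln1 subr0 mul1r.
by rewrite subr_ge0; apply: jconc_operator hf t01 p1 p2; exact: jconc_ln.
Qed.

End LogTraces.

(** * Reduction of the deformed trace function to powers or exponentials, and the choice of
    exponents *)

Section DeformedTraces.
Variables (R : realType) (n : nat).
Local Notation C := R[i].
Local Notation pw s := (fun x : R => x `^ s).

Lemma qform0r (A : 'M[C]_n) : qform A 0 = 0.
Proof. by rewrite /qform mulmx0 mxE. Qed.

Lemma psdmxD (A B : 'M[C]_n) : psdmx A -> psdmx B -> psdmx (A + B).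
Proof.
move=> /psdmxP[hA pA] /psdmxP[hB pB]; apply/psdmxP; split; first exact: selfadjD.
by move=> v; rewrite qformD addr_ge0.
Qed.

Lemma psdmxZ (c : R) (A : 'M[C]_n) : 0 <= c -> psdmx A -> psdmx (c%:C *: A).
Proof.
move=> c0 /psdmxP[hA pA]; apply/psdmxP; split; first exact: selfadjZ.
by move=> v; rewrite qformZ mulr_ge0.
Qed.

Lemma contraction_psd (H : 'M[C]_n) : contraction H ->
  psdmx (1%:M - adj H *m H).
Proof.
move=> hH; apply/psdmxP; split.
  apply/selfadjP; by rewrite adjD adjN adj_1mx adjM adjK.
move=> v; have := hH v; rewrite !adj_sqE lecR.
have q1 w : qform (1%:M : 'M[C]_n) w = \sum_i nsq (w i 0).
  by rewrite /qform mulmx1 adj_sqE.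
rewrite qformD qformN -{1}(mulmx1 (adj H)) qform_conj !q1.
by rewrite subr_ge0.
Qed.

Lemma concave_pd_of (phi : 'M[C]_n -> C) (F : 'M[C]_n -> R) :
  (forall A, phi A = (F A)%:C) ->
  (forall t A B, 0 <= t <= 1 -> pdmx A -> pdmx B ->
     t * F A + (1 - t) * F B <= F (mix t A B)) -> concave_pd phi.
Proof.
move=> hF hc A B pA pB t t01; rewrite !hF -!rmorphM -rmorphD lecR.
exact: hc.
Qed.

(** Convexity is phrased as concavity of [- F], so that the concavity lemmas serve both. *)
Lemma convex_pd_of (phi : 'M[C]_n -> C) (F : 'M[C]_n -> R) :
  (forall A, phi A = (F A)%:C) ->
  (forall t A B, 0 <= t <= 1 -> pdmx A -> pdmx B ->
     t * (- F A) + (1 - t) * (- F B) <= - F (mix t A B)) -> convex_pd phi.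
Proof.
move=> hF hc A B pA pB t t01; rewrite !hF -!rmorphM -rmorphD lecR.
have := hc t A B t01 pA pB; rewrite !mulrN -opprD lerN2.
exact.
Qed.

Lemma mxtrace_fcalc_rtr f (A : 'M[C]_n) : \tr (fcalc f A) = (rtr (fcalc f A))%:C.
Proof. by rewrite mxtrace_fcalc rtr_fcalc. Qed.

Lemma phiLpq1E (H L : 'M[C]_n) (q : R) A : selfadj L ->
  phiLpq H L 1 q A = (rtr (fcalc (fun x => expR (q * x)) (logX L H A)))%:C.
Proof.
move=> hL; rewrite -mxtrace_fcalc_rtr /phiLpq !mxfun_fcalc fcalc_comp /logX.
rewrite (_ : fcalc (logp 1) A = fcalc (@ln R) A); last first.
  by apply: eq_fcalc => i; rewrite /logp eqxx.
by congr (\tr _); apply: eq_fcalc => i; rewrite /= /expp eqxx -expRM mulrC.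
Qed.

(** Since (p-1) log_p A = A^(p-1) - 1, the matrix 1 + (p-1) X is Y(A), and exp_p(x)^q = (1 + (p-1)
    x)^(q/(p-1)). *)
Lemma phiLpqE (H L M : 'M[C]_n) (p q : R) A : selfadj L -> p != 1 ->
  adj M *m M = (p - 1)%:C *: L + (1%:M - adj H *m H) ->
  phiLpq H L p q A = (rtr (fcalc (pw (q / (p - 1))) (powY M H (p - 1) A)))%:C.
Proof.
move=> hL p1 hM; have s0 : p - 1 != 0 by rewrite subr_eq0.
rewrite -mxtrace_fcalc_rtr /phiLpq !mxfun_fcalc fcalc_comp; congr (\tr _).
set X := L + _.
have hX : selfadj X := selfadjD hL (selfadj_conj H (selfadj_fcalc _ A)).
have -> : powY M H (p - 1) A = fcalc (fun x => 1 + (p - 1) * x) X.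
  rewrite fcalc_affine // /powY hM /X scalerDr scalemxAl scalemxAr.
  have -> : (p - 1)%:C *: fcalc (logp p) A = fcalc (pw (p - 1)) A - 1%:M.
    have e1 : 1%:M = fcalc (fun=> 1) A by rewrite fcalc_cst.
    apply: (canRL (addrK _)); rewrite [X in _ + X]e1 fcalcZ fcalcD.
    by apply: eq_fcalc => i; rewrite /logp (negPf p1) /=; field.
  rewrite mulmxBr mulmx1 mulmxBl.
  have regroup (V : zmodType) (x y z w : V) : x + (y - z) + w = y + (x + (w - z)).
    by rewrite !addrA (addrAC _ (- z)) (addrC y x).
  exact: regroup.
rewrite fcalc_comp; apply: eq_fcalc => i /=.
by rewrite /expp (negPf p1) -powRrM; congr (_ `^ _); [ring | field].
Qed.

(** If H v is nonzero, the term in A^s is positive at v; if H v = 0, the form of 1 - H^* H at v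
    equals |v|^2. *)
Lemma pdmx_powY (H L M A : 'M[C]_n) (s : R) : contraction H -> selfadj L ->
  psdmx (s%:C *: L) -> adj M *m M = s%:C *: L + (1%:M - adj H *m H) ->
  pdmx A -> pdmx (powY M H s A).
Proof.
move=> hH hL psL hM pA; apply/pdmxP; split; first exact: selfadj_powY.
move=> v v0; rewrite /powY hM qformD qform_conj qformD.
have /psdmxP[_ /(_ v) h1] := psL.
have /psdmxP[_ /(_ v) h2] := contraction_psd hH.
have pAs : pdmx (fcalc (pw s) A) by apply: pdmx_fcalc => i; rewrite powR_gt0 // eigv_gt0.
have [Hv|Hv] := eqVneq (H *m v) 0; last first.
  have /pdmxP[_ /(_ _ Hv) h3] := pAs.
  by rewrite ltr_wpDl // addr_ge0.
rewrite Hv qform0r addr0.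
have -> : qform (1%:M - adj H *m H) v = qform 1%:M v.
  rewrite qformD qformN -{1}(mulmx1 (adj H)) qform_conj Hv.
  by rewrite qform0r subr0.
have /pdmxP[_ /(_ _ v0) h3] := pdmx1 R n.
by rewrite ltr_wpDl.
Qed.

Lemma jconc_cpowR (c s : R) :
  (0 <= c /\ 0 <= s <= 1) \/ (c <= 0 /\ (-1 <= s <= 0 \/ 1 <= s <= 2)) ->
  jconc (fun a b : R => c * (a `^ s * b `^ (1 - s))).
Proof.
case=> -[c0 hs]; first exact: jconcZ c0 (jconc_powR hs).
have nc : 0 <= - c by lra.
apply: eq_jconc (jconcZ nc (jconcN_powR hs)) => a b _ _.
by rewrite mulrNN.
Qed.

(** With s = p - 1 and r s = q, the alternatives are cases (b), (a), (c), (d), (e) of the theorem in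
    this order; c = -1 encodes convexity. *)
Lemma tr_powY_concave (H M : 'M[C]_n) (c s r : R) :
  (forall A, pdmx A -> pdmx (powY M H s A)) ->
  [/\ c = 1, 0 < s <= 1, 0 <= r & r * s <= 1] \/
  [/\ c = 1, -1 <= s < 0, r <= 0 & r * s <= 1] \/
  [/\ c = -1, -1 <= s < 0 & 0 <= r] \/
  [/\ c = -1, 0 < s <= 1 & r <= 0] \/
  [/\ c = -1, 1 <= s <= 2, 0 <= r & 1 <= r * s] ->
  forall t A1 A2, 0 <= t <= 1 -> pdmx A1 -> pdmx A2 ->
  t * rtr (fcalc (fun y => c * y `^ r) (powY M H s A1)) +
  (1 - t) * rtr (fcalc (fun y => c * y `^ r) (powY M H s A2)) <=
  rtr (fcalc (fun y => c * y `^ r) (powY M H s (mix t A1 A2))).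
Proof.
move=> pY hcase t A1 A2 t01 p1 p2.
case: hcase => [[-> hs r0 rs]|[[-> hs r0 rs]|[[-> hs r0]|[[-> hs r0]|[-> hs r0 rs]]]]].
(* For r <= 1 tangents suffice, y^r being concave and nondecreasing; for r > 1 it is convex and the
   variational formula takes over. *)
- have [r1|r1] := leP r 1.
    apply: tr_powY_single => // [u u0|].
      by rewrite !mul1r powR_le_tangent1 // r0.
    by rewrite mul1r; apply: jconc_cpowR; left; split=> //; lra.
  have s1 : s < 1 by nra.
  have ns1 : s != 1 by rewrite (lt_eqF s1).
  have nr1 : r != 1 by rewrite (gt_eqF r1).
  apply: tr_powY_joint => // [u u0||u u0].
  + by rewrite !mul1r powR_ge_tangent1 //; right; exact: ltW.
  + by rewrite mul1r; apply: jconc_cpowR; left; split=> //; lra.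
  (* Since r > 1, the condition e >= 1 amounts to r s <= 1. *)
  + have n0 : 1 * (1 - r) <= 0 by lra.
    apply: ler_wnM2l => //; apply: powR_ge_tangent1 => //; right.
    by rewrite ler_pdivlMr ?subr_gt0 //; lra.
- have r1 : r < 1 by lra.
  have s1 : s < 1 by lra.
  have ns1 : s != 1 by rewrite (lt_eqF s1).
  have nr1 : r != 1 by rewrite (lt_eqF r1).
  apply: tr_powY_joint => // [u u0||u u0].
  + by rewrite !mul1r powR_ge_tangent1 //; left.
  + by rewrite mul1r; apply: jconc_cpowR; right; split=> //; left; lra.
  (* Here e >= 0 follows from r <= 0, and e <= 1 amounts to r s <= 1. *)
  + have n0 : 0 <= 1 * (1 - r) by lra.
    apply: ler_wpM2l => //; apply: powR_le_tangent1 => //.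
    have -> : r * (1 - s) / (r - 1) = (- r * (1 - s)) / (1 - r).
      by field; rewrite !subr_eq0 (lt_eqF r1) eq_sym (lt_eqF r1).
    by rewrite ler_pdivlMr ?ler_pdivrMr ?subr_gt0 //; nra.
- have [r1|r1] := leP 1 r.
    apply: tr_powY_single => // [u u0|].
      by rewrite !mulN1r lerN2 powR_ge_tangent1 //; right.
    by rewrite mulN1r; apply: jconc_cpowR; right; split; [lra | left; lra].
  have s1 : s < 1 by lra.
  have ns1 : s != 1 by rewrite (lt_eqF s1).
  have nr1 : r != 1 by rewrite (lt_eqF r1).
  apply: tr_powY_joint => // [u u0||u u0].
  + by rewrite !mulN1r lerN2 powR_le_tangent1 // r0 ltW.
  + by rewrite mulN1r; apply: jconc_cpowR; right; split; [lra | left; lra].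
  (* Here e <= 0, as 0 <= r < 1 and s < 0. *)
  + have n0 : -1 * (1 - r) <= 0 by lra.
    apply: ler_wnM2l => //; apply: powR_ge_tangent1 => //; left.
    have -> : r * (1 - s) / (r - 1) = - (r * (1 - s) / (1 - r)).
      by field; rewrite !subr_eq0 (lt_eqF r1) eq_sym (lt_eqF r1).
    by rewrite oppr_le0 divr_ge0 ?mulr_ge0 //; lra.
- apply: tr_powY_single => // [u u0|].
    by rewrite !mulN1r lerN2 powR_ge_tangent1 //; left.
  by rewrite mulN1r; apply: jconc_cpowR; left; split; lra.
- have [r1|r1] := leP 1 r.
    apply: tr_powY_single => // [u u0|].
      by rewrite !mulN1r lerN2 powR_ge_tangent1 //; right.
    by rewrite mulN1r; apply: jconc_cpowR; right; split; [lra | right; lra].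
  have s1 : 1 < s by nra.
  have ns1 : s != 1 by rewrite (gt_eqF s1).
  have nr1 : r != 1 by rewrite (lt_eqF r1).
  apply: tr_powY_joint => // [u u0||u u0].
  + by rewrite !mulN1r lerN2 powR_le_tangent1 // r0 ltW.
  + by rewrite mulN1r; apply: jconc_cpowR; right; split; [lra | right; lra].
  (* Since r < 1, the condition e >= 1 amounts to r s >= 1. *)
  + have n0 : -1 * (1 - r) <= 0 by lra.
    apply: ler_wnM2l => //; apply: powR_ge_tangent1 => //; right.
    have -> : r * (1 - s) / (r - 1) = r * (s - 1) / (1 - r).
      by field; rewrite !subr_eq0 (lt_eqF r1) eq_sym (lt_eqF r1).
    by rewrite ler_pdivlMr ?subr_gt0 //; lra.
Qed.

Lemma eq_combination (F G : 'M[C]_n -> R) (t : R) (Y1 Y2 Y : 'M[C]_n) : F =1 G ->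
  t * F Y1 + (1 - t) * F Y2 <= F Y -> t * G Y1 + (1 - t) * G Y2 <= G Y.
Proof. by move=> e; rewrite !e. Qed.

Lemma rtr_fcalcN f (A : 'M[C]_n) : rtr (fcalc (fun x => - f x) A) = - rtr (fcalc f A).
Proof. by rewrite !rtr_fcalc sumrN. Qed.

End DeformedTraces.

(** * The five cases, by powers when p differs from 1 and by logarithms when p = 1 *)

Unset Implicit Arguments.

Theorem theorem4p1 (R : realType) (n : nat) (H L : 'M[R[i]]_n) (p q : R) :
  (0 < n)%N -> contraction H -> selfadj L ->
  [/\ (0 <= p <= 1 -> psdmx (- L) -> 0 <= q <= 1 -> concave_pd (phiLpq H L p q)),
      (1 <= p <= 2 -> psdmx L -> 0 <= q <= 1 -> concave_pd (phiLpq H L p q)),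
      (0 <= p <= 1 -> psdmx (- L) -> q <= 0 -> convex_pd (phiLpq H L p q)),
      (1 <= p <= 2 -> psdmx L -> q <= 0 -> convex_pd (phiLpq H L p q)) &
      (2 <= p <= 3 -> psdmx L -> 1 <= q -> convex_pd (phiLpq H L p q))].
Proof.
move=> _ hH hL.
have concave_power (p' q' : R) : p' != 1 -> psdmx ((p' - 1)%:C *: L) ->
    0 < p' - 1 <= 1 /\ 0 <= q' <= 1 \/ -1 <= p' - 1 < 0 /\ 0 <= q' <= 1 ->
    concave_pd (phiLpq H L p' q').
  move=> p1 psL hpq; have s0 : p' - 1 != 0 by rewrite subr_eq0.
  have [M hM] := psdmx_sqrt (psdmxD psL (contraction_psd hH)).
  apply: (concave_pd_of (fun A => phiLpqE q' A hL p1 hM)) => t A B t01 pA pB.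
  apply: (eq_combination (F := fun Y => rtr (fcalc (fun y => 1 * y `^ (q' / (p' - 1))) Y))
    (G := fun Y => rtr (fcalc (fun y => y `^ (q' / (p' - 1))) Y))) => [Y|].
    by congr rtr; apply: eq_fcalc => i; rewrite mul1r.
  apply: tr_powY_concave t01 pA pB; first by move=> D; apply: pdmx_powY psL hM.
  case: hpq => -[hs /andP[q0 q1]]; [left | right; left].
    by split=> //; [rewrite divr_ge0 // ltW; case/andP: hs | rewrite divfK].
  split=> //; last by rewrite divfK.
  by rewrite mulr_ge0_le0 // invr_le0 ltW; case/andP: hs.
have convex_power (p' q' : R) : p' != 1 -> psdmx ((p' - 1)%:C *: L) ->
    [\/ 0 < p' - 1 <= 1 /\ q' <= 0, -1 <= p' - 1 < 0 /\ q' <= 0 |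
        1 <= p' - 1 <= 2 /\ 1 <= q'] ->
    convex_pd (phiLpq H L p' q').
  move=> p1 psL hpq; have s0 : p' - 1 != 0 by rewrite subr_eq0.
  have [M hM] := psdmx_sqrt (psdmxD psL (contraction_psd hH)).
  apply: (convex_pd_of (fun A => phiLpqE q' A hL p1 hM)) => t A B t01 pA pB.
  apply: (eq_combination (F := fun Y => rtr (fcalc (fun y => -1 * y `^ (q' / (p' - 1))) Y))
    (G := fun Y => - rtr (fcalc (fun y => y `^ (q' / (p' - 1))) Y))) => [Y|].
    by rewrite -rtr_fcalcN; congr rtr; apply: eq_fcalc => i; rewrite mulN1r.
  apply: tr_powY_concave t01 pA pB; first by move=> D; apply: pdmx_powY psL hM.
  case: hpq => -[hs hq]; right; right; [right; left | left | right; right].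
  - by split=> //; rewrite mulr_le0_ge0 // invr_ge0 ltW; case/andP: hs.
  - by split=> //; rewrite mulr_le0 // invr_le0 ltW; case/andP: hs.
  - by split=> //; [rewrite divr_ge0 //; lra | rewrite divfK].
have concave_log (q' : R) : 0 <= q' <= 1 -> concave_pd (phiLpq H L 1 q').
  have [M hM] := psdmx_sqrt (contraction_psd hH).
  move=> hq; apply: (concave_pd_of (fun A => phiLpq1E H q' A hL)) => t A B t01 pA pB.
  exact: tr_logX_joint hM t01 pA pB hq.
have convex_log (q' : R) : q' <= 0 -> convex_pd (phiLpq H L 1 q').
  move=> hq; apply: (convex_pd_of (fun A => phiLpq1E H q' A hL)) => t A B t01 pA pB.
  apply: (eq_combination (F := fun Y => rtr (fcalc (fun x => - expR (q' * x)) Y))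
    (G := fun Y => - rtr (fcalc (fun x => expR (q' * x)) Y))) => [Y|].
    exact: rtr_fcalcN.
  have h := tr_logX_single H hL t01 pA pB hq.
  exact: h.
(* Either sign condition on [L] makes (p-1) L positive semidefinite, so the power cases on both
   sides of 1 are treated alike. *)
have psN : p <= 1 -> psdmx (- L) -> psdmx ((p - 1)%:C *: L).
  move=> p1 hN; rewrite -[L]opprK scalerN -scaleNr -rmorphN.
  by apply: psdmxZ => //; lra.
have psP : 1 <= p -> psdmx L -> psdmx ((p - 1)%:C *: L).
  by move=> p1 hN; apply: psdmxZ => //; lra.
split=> /andP[p0 p1] hpL hq.
- have [->|np] := eqVneq p 1; first exact: concave_log.
  apply: (concave_power _ _ np (psN p1 hpL)).
  have p1' : p < 1 by rewrite lt_neqAle np.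
  by right; split=> //; lra.
- have [->|np] := eqVneq p 1; first exact: concave_log.
  apply: (concave_power _ _ np (psP p0 hpL)).
  have p1' : 1 < p by rewrite lt_neqAle eq_sym np.
  by left; split=> //; lra.
- have [->|np] := eqVneq p 1; first exact: convex_log.
  apply: (convex_power _ _ np (psN p1 hpL)).
  have p1' : p < 1 by rewrite lt_neqAle np.
  by apply: Or32; split=> //; lra.
- have [->|np] := eqVneq p 1; first exact: convex_log.
  apply: (convex_power _ _ np (psP p0 hpL)).
  have p1' : 1 < p by rewrite lt_neqAle eq_sym np.
  by apply: Or31; split=> //; lra.
- have p1' : 1 < p by lra.
  apply: (convex_power _ _ (negbT (gt_eqF p1')) (psP (ltW p1') hpL)).
  by apply: Or33; split=> //; lra.
Qed.
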